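(* Let $k$ be a (not necessarily algebraically closed) field of characteristic two, let $K=k((t))$ with fixed algebraic closure $K^{\mathrm{alg}}$, and let $L\subseteq K^{\mathrm{alg}}$ be a totally ramified Galois extension of $K$ with $\mathrm{Gal}(L|K)\cong D_4$. Let $F,G,H\in K$ and $q,r,s\in K^{\mathrm{alg}}$ be such that $q^2+q=F$, $r^2+r=Gq+H$, $s^2+s=G$, and $L=K[q,r,s]$; assume that each of $f=\deg_{t^{-1}}F$, $g=\deg_{t^{-1}}G$ and $d=\deg_{t^{-1}}(F+G)$ is both positive and odd, that $h=\deg_{t^{-1}}H$ is not both positive and even, and that $f\le g$. Let $c_q$, $c_s$ and $c_{q+s}$ denote the conductors over $K$ of $K[q]$, $K[s]$ and $K[q+s]$, respectively, and let $c_r$ denote the conductor of $K[q,r]$ over $K[q]$. Then the lower ramification breaks of $L$ over $K$ are $$\ell_1=\min\{c_{q+s},c_q\},\quad \ell_2=2c_s-\min\{c_{q+s},c_q\},\quad \ell_3=2c_q+2c_r-2c_s-\min\{c_{q+s},c_q\},$$ and the upper ramification breaks of $L$ over $K$ are $$u_1=\min\{c_{q+s},c_q\},\quad u_2=c_s,\quad u_3=(c_q+c_r)/2.$$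
   Context: $D_4$ is the dihedral group of order 8. For a nonzero $X\in k((t))$, $\deg_{t^{-1}}X$ is the largest integer $n$ such that $t^{-n}$ has nonzero coefficient in $X$ (i.e. minus the $t$-adic valuation); the zero element is regarded as having non-positive degree. For a totally ramified Galois extension with group $\Gamma$ of order $2^n$, let $\Gamma_j$ and $\Gamma^j$ be the lower and upper (Serre) numbering ramification groups. The $i$th lower ramification break is $\ell_i=\max\{\nu: |\Gamma_\nu|\ge 2^{n+1-i}\}$ and the $i$th upper ramification break is $u_i=\max\{\nu: |\Gamma^\nu|\ge 2^{n+1-i}\}$, for $1\le i\le n$. If $\Gamma$ has order two, its unique ramification break is called the conductor of the extension. *)

(* Defs.v *)
From HB Require Import structures.
From mathcomp Require Export all_boot all_order all_algebra all_fingroup.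
From mathcomp Require Export all_solvable all_field.
From mathcomp Require Export boolp classical_sets functions cardinality fsbigop.
From mathcomp Require Export reals.
From mathcomp Require Import zify.
Set Implicit Arguments.
Unset Strict Implicit.
Unset Printing Implicit Defensive.
Import Order.TTheory GRing.Theory Num.Theory.
Local Open Scope classical_set_scope.
Local Open Scope ring_scope.

Section LaurentType.
Variable k : fieldType.

Definition bounded_below : {pred int -> k} :=
  [pred a | `[< exists N : int, forall n, n < N -> a n = 0 >]].

Fact bounded_below_zmod_closed : zmod_closed bounded_below.
Proof.
split=> [|a b /asboolP[N aN] /asboolP[M bM]]; first by apply/asboolP; exists 0.
apply/asboolP; exists (Num.min N M) => n; rewrite lt_min => /andP[nN nM].
by rewrite [LHS](_ : _ = a n - b n)// aN// bM// subrr.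
Qed.

HB.instance Definition _ :=
  GRing.isZmodClosed.Build (int -> k) bounded_below bounded_below_zmod_closed.

(* The field k((t)): the term of degree n of a is (coefl a n) t^n. *)
Record laurent := Laurent {
  coefl :> int -> k;
  coefl_bounded_below : coefl \in bounded_below }.

HB.instance Definition _ := [isSub for coefl].
HB.instance Definition _ := [Choice of laurent by <:].
HB.instance Definition _ := [SubChoice_isSubZmodule of laurent by <:].

Implicit Types a b c : laurent.

Lemma laurent_eq a b : (forall n, a n = b n) -> a = b.
Proof. by move=> ab; apply/val_inj/funext. Qed.

Lemma coeflD a b n : (a + b) n = a n + b n.
Proof. by []. Qed.

Lemma coefl0 n : (0 : laurent) n = 0.
Proof. by []. Qed.

Definition vanish_below (a : int -> k) (N : int) := forall n, n < N -> a n = 0.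

Lemma vanish_belowP a : exists N, vanish_below a N.
Proof. exact/asboolP/(coefl_bounded_below a). Qed.

Lemma vanish_below_le (a : int -> k) N M : M <= N -> vanish_below a N -> vanish_below a M.
Proof. by move=> MN aN n nM; apply: aN; apply: lt_le_trans MN. Qed.

Definition cauchy (a b : int -> k) (n : int) : k :=
  \sum_(i \in [set: int]) a i * b (n - i).

Lemma cauchyE (a b : int -> k) N M (n : nat) : vanish_below a N -> vanish_below b M ->
  cauchy a b (n%:Z + N + M) =
  \sum_(j < n.+1) a (j%:Z + N) * b ((n - j)%N%:Z + M).
Proof.
move=> aN bM; rewrite /cauchy.
rewrite (fsbigE [seq j%:Z + N | j <- iota 0 n.+1])//; last 2 first.
- by rewrite map_inj_uniq ?iota_uniq// => i j; lia.
- move=> i _; apply: contraNeq => ne0; have iN : N <= i.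
    by rewrite leNgt; apply: contraNN ne0 => /aN ->; rewrite mul0r.
  have iM : M <= n%:Z + N + M - i.
    by rewrite leNgt; apply: contraNN ne0 => /bM ->; rewrite mulr0.
  by apply/mapP; exists `|i - N|%N; [rewrite mem_iota; lia|lia].
transitivity (\sum_(j <- [seq j%:Z + N | j <- iota 0 n.+1])
    a j * b (n%:Z + N + M - j)).
  by apply: eq_bigl => i; rewrite in_setT.
rewrite big_map -[iota _ _]/(index_iota 0 n.+1) big_mkord.
apply: eq_bigr => j _; congr (_ * b _); have := ltn_ord j; lia.
Qed.

Lemma cauchy_lbound (a b : int -> k) N M : vanish_below a N -> vanish_below b M ->
  vanish_below (cauchy a b) (N + M).
Proof.
move=> aN bM n nNM; rewrite /cauchy fsbig1// => i _.
case: (ltP i N) => [/aN ->|iN]; first by rewrite mul0r.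
by rewrite bM ?mulr0//; lia.
Qed.

Fact cauchy_bounded_below a b : cauchy a b \in bounded_below.
Proof.
have [N aN] := vanish_belowP a; have [M bM] := vanish_belowP b.
by apply/asboolP; exists (N + M); apply: cauchy_lbound.
Qed.

Definition mull a b := Laurent (cauchy_bounded_below a b).

Definition monol_coef (x : k) (m : int) (n : int) := if n == m then x else 0.

Fact monol_bounded_below x m : monol_coef x m \in bounded_below.
Proof.
by apply/asboolP; exists m => n nm; rewrite /monol_coef lt_eqF.
Qed.

Definition monol x m := Laurent (monol_bounded_below x m).

Let trunc (a : int -> k) N n := \poly_(i < n.+1) a (i%:Z + N).

Lemma cauchy_trunc (a b : int -> k) N M (n j : nat) :
  vanish_below a N -> vanish_below b M -> (j <= n)%N ->
  cauchy a b (j%:Z + (N + M)) = (trunc a N n * trunc b M n)`_j.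
Proof.
move=> aN bM jn; rewrite addrA cauchyE// coefM; apply: eq_bigr => i _.
by rewrite !coef_poly !ifT//; have := ltn_ord i; lia.
Qed.

Lemma truncM (a b : int -> k) N M n i : vanish_below a N -> vanish_below b M ->
  (i <= n)%N -> (trunc (cauchy a b) (N + M) n)`_i = (trunc a N n * trunc b M n)`_i.
Proof. by move=> aN bM iN; rewrite coef_poly ltnS iN (cauchy_trunc aN bM iN). Qed.

Lemma vanish_below_ext (a b : int -> k) N : vanish_below a N -> vanish_below b N ->
  (forall n : nat, a (n%:Z + N) = b (n%:Z + N)) -> a =1 b.
Proof.
move=> aN bN ab m; case: (ltP m N) => mN; first by rewrite aN ?bN.
by have -> : m = `|m - N|%N%:Z + N by lia.
Qed.

Fact mullC : commutative mull.
Proof.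
move=> a b; have [N aN] := vanish_belowP a; have [M bM] := vanish_belowP b.
apply: laurent_eq; apply: (@vanish_below_ext _ _ (N + M)) => /=.
- exact: cauchy_lbound.
- by rewrite addrC; apply: cauchy_lbound.
move=> n; rewrite (cauchy_trunc aN bM (leqnn n)) (addrC N).
by rewrite (cauchy_trunc bM aN (leqnn n)) mulrC.
Qed.

Fact mullA : associative mull.
Proof.
move=> a b c; have [N aN] := vanish_belowP a; have [M bM] := vanish_belowP b.
have [P cP] := vanish_belowP c.
have abl := cauchy_lbound aN bM; have bcl := cauchy_lbound bM cP.
apply: laurent_eq; apply: (@vanish_below_ext _ _ (N + M + P)) => /=.
- by rewrite -addrA; apply: cauchy_lbound.
- exact: cauchy_lbound.
move=> n; rewrite (cauchy_trunc abl cP (leqnn n)) -addrA.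
rewrite (cauchy_trunc aN bcl (leqnn n)).
transitivity ((trunc a N n * (trunc b M n * trunc c P n))`_n); last first.
  rewrite mulrA !coefM; apply: eq_bigr => i _.
  by rewrite truncM// -ltnS.
by rewrite !coefM; apply: eq_bigr => i _; rewrite truncM// leq_subr.
Qed.

Fact mul1l : left_id (monol 1 0) mull.
Proof.
move=> a; have [N aN] := vanish_belowP a.
have l1 : vanish_below (monol 1 0) 0.
  by move=> n n0; rewrite /= /monol_coef lt_eqF.
apply: laurent_eq; apply: (@vanish_below_ext _ _ (0 + N)) => /=.
- exact: cauchy_lbound.
- by rewrite add0r.
move=> n; rewrite addrA cauchyE// big_ord_recl/= big1 ?addr0 ?subn0 /monol_coef.
  by rewrite mul1r.
by move=> i _; rewrite mul0r.
Qed.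

Fact mullDl : left_distributive mull +%R.
Proof.
move=> a b c; have [N' aN'] := vanish_belowP a; have [M' bM'] := vanish_belowP b.
have [P cP] := vanish_belowP c.
have aN : vanish_below a (Num.min N' M') by apply: vanish_below_le aN'; rewrite ge_min lexx.
have bN : vanish_below b (Num.min N' M').
  by apply: vanish_below_le bM'; rewrite ge_min lexx orbT.
set N := Num.min N' M' in aN bN.
have abN : vanish_below (a + b) N.
  by move=> n nN; rewrite coeflD aN// bN// addr0.
apply: laurent_eq; apply: (@vanish_below_ext _ _ (N + P)).
- exact: cauchy_lbound.
- move=> n nN; rewrite coeflD /= (cauchy_lbound aN cP)//.
  by rewrite (cauchy_lbound bN cP)// addr0.
move=> n; rewrite coeflD addrA [LHS]cauchyE// [(mull a c) _]cauchyE//.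
rewrite [(mull b c) _]cauchyE// -big_split/=; apply: eq_bigr => i _.
by rewrite -mulrDl.
Qed.

Fact onel_neq0 : monol 1 0 != 0.
Proof.
apply/eqP => /(congr1 (fun a : laurent => a 0)).
by rewrite /= /monol_coef eqxx => /eqP; rewrite oner_eq0.
Qed.

HB.instance Definition _ := GRing.Zmodule_isComNzRing.Build laurent
  mullA mullC mul1l mullDl onel_neq0.

Lemma coeflM a b n : (a * b) n = \sum_(i \in [set: int]) a i * b (n - i).
Proof. by []. Qed.

Lemma coefl1 n : (1 : laurent) n = if n == 0 then 1 else 0.
Proof. by []. Qed.

Section PowerSeriesInverse.
Variable u : nat -> k.
Hypothesis u0 : u 0 != 0.

Fixpoint pinv_seq (n : nat) : seq k :=
  if n is n'.+1 then
    let s := pinv_seq n' in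
    rcons s ((u 0)^-1 * ((n' == 0)%:R - \sum_(i < n') s`_i * u (n' - i)%N))
  else [::].

Let size_pinv_seq n : size (pinv_seq n) = n.
Proof. by elim: n => //= n IH; rewrite size_rcons IH. Qed.

Let nth_pinv_seq n m i : (i < n)%N -> (n <= m)%N ->
  (pinv_seq m)`_i = (pinv_seq n)`_i.
Proof.
move=> i_n; elim: m => [|m IH]; first by rewrite leqn0 => /eqP <-.
rewrite leq_eqVlt => /orP[/eqP <-//|]; rewrite ltnS => nm.
by rewrite /= nth_rcons size_pinv_seq (leq_trans i_n nm) IH.
Qed.

Lemma power_series_inverse : exists v : nat -> k, forall n,
  \sum_(j < n.+1) v j * u (n - j)%N = (n == 0)%:R.
Proof.
exists (fun n => (pinv_seq n.+1)`_n) => n.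
rewrite big_ord_recr/= subnn nth_rcons size_pinv_seq ltnn eqxx.
rewrite [_ * u 0%N]mulrC mulVKf// addrC -addrA [- _ + _]addrC.
rewrite [X in X - _](_ : _ = \sum_(i < n) (pinv_seq n)`_i * u (n - i)%N).
  by rewrite subrr addr0.
apply: eq_bigr => i _; congr (_ * _).
by symmetry; apply: (@nth_pinv_seq i.+1 n i).
Qed.

End PowerSeriesInverse.

Lemma laurent_order a : a != 0 -> exists m, a m != 0 /\ vanish_below a m.
Proof.
move=> a0; have [N aN] := vanish_belowP a.
have exn : exists n : nat, a (n%:Z + N) != 0.
  apply/not_existsP => h; move/eqP: a0; apply; apply: laurent_eq => m.
  rewrite coefl0; case: (ltP m N) => [/aN//|Nm].
  have -> : m = `|m - N|%N%:Z + N by lia.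
  by apply/eqP; apply: contra_notT (h `|m - N|%N).
exists ((ex_minn exn)%:Z + N); case: ex_minnP => n an nmin; split=> // i iN.
case: (ltP i N) => [/aN//|Ni]; apply/eqP/negPn/negP => ai0.
have := nmin `|i - N|%N; rewrite (_ : _%:Z + N = i); last by lia.
by move=> /(_ ai0); lia.
Qed.

Lemma laurent_inverse a : a != 0 -> exists b, b * a = 1.
Proof.
move=> /laurent_order[m [am0 am]].
have [|v vE] := @power_series_inverse (fun n => a (n%:Z + m)).
  by rewrite add0r.
pose b (n : int) := if n < - m then 0 else v (absz (n + m)).
have bm : vanish_below b (- m) by move=> n nm; rewrite /b nm.
have bb : b \in bounded_below by apply/asboolP; exists (- m).
exists (Laurent bb); apply: laurent_eq.
apply: (@vanish_below_ext _ _ (- m + m)).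
- exact: cauchy_lbound.
- by move=> n; rewrite addNr coefl1 => n0; rewrite lt_eqF.
move=> n; rewrite addrA coefl1 [LHS]cauchyE//.
rewrite subrK; transitivity ((n == 0)%:R : k); last first.
  by case: n.
rewrite -vE; apply: eq_bigr => i _; congr (_ * _).
by rewrite /b/= ifF; [congr (v _); lia | lia].
Qed.

Definition invl a : laurent := xget 0 [set b | b * a = 1].

Fact mulVl a : a != 0 -> invl a * a = 1.
Proof.
by move=> /laurent_inverse ab; exact: (@xgetPex _ 0 [set b | b * a = 1] ab).
Qed.

Fact invl0 : invl 0 = 0.
Proof.
rewrite /invl; case: xgetP => // b -> /esym/eqP.
by rewrite mulr0 oner_eq0.
Qed.

HB.instance Definition _ := GRing.ComNzRing_isField.Build laurent mulVl invl0.

End LaurentType.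

Section Ramification.
Variables (k : fieldType) (L : splittingFieldType (laurent k)).
Implicit Types (E M : {subfield L}).

(* 0 at X = 0; otherwise minus the t-adic valuation of X. *)
Definition degtV (X : laurent k) : int :=
  xget 0 [set n : int | X (- n) != 0 /\ forall m : int, n < m -> X (- m) = 0].

(* v restricts to a discrete valuation of M with value group Z extending, up to
   the ramification index e, the t-adic valuation of k((t)); the value of v at
   0 and its values outside M carry no information. *)
Definition normalized_valuation M (v : L -> int) : Prop :=
  [/\ forall x y, x \in M -> y \in M -> x != 0 -> y != 0 ->
        v (x * y) = v x + v y,
      forall x y, x \in M -> y \in M -> x != 0 -> y != 0 -> x + y != 0 ->
        Num.min (v x) (v y) <= v (x + y),
      exists x, [/\ x \in M, x != 0 & v x = 1] &
      exists2 e : nat, (0 < e)%N &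
        forall X : laurent k, X != 0 -> v X%:A = - degtV X *+ e].

(* As k((t)) is complete, such a valuation exists and is unique on M. *)
Definition valuation M : L -> int :=
  xget (fun=> 0) [set v | normalized_valuation M v].

(* The valuation of t = monol 1 1 is the ramification index of M over k((t)). *)
Definition totally_ramified M : Prop :=
  valuation M (monol (1 : k) 1)%:A = (\dim M)%:Z.

Variable R : realType.

(* For real nu, the group G_nu of M over E with G_nu = G_i, i the ceiling of
   nu: the condition on s is v_M(s x - x) >= nu + 1 for every integral x. *)
Definition lower_group E M (nu : R) : {set gal_of M} :=
  [set s in 'Gal(M / E)%g | `[< forall x, x \in M -> x != 0 ->
     0 <= valuation M x -> s x != x ->
     nu + 1 <= (valuation M (s x - x))%:~R >]].

(* phi u is the integral from 0 to u of dx / (G_0 : G_x), where G_x, for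
   -1 <= x <= 0, counts with index 1. *)
Definition herbrand_phi E M (u : R) : R :=
  if u <= 0 then u else
  let m := Num.truncn u in
  (\sum_(1 <= i < m.+1) #|lower_group E M i%:R|%:R
   + (u - m%:R) * #|lower_group E M m.+1%:R|%:R) / #|lower_group E M 0|%:R.

Definition herbrand_psi E M (v : R) : R :=
  xget 0 [set u | herbrand_phi E M u = v].

Definition upper_group E M (nu : R) : {set gal_of M} :=
  lower_group E M (herbrand_psi E M nu).

Definition is_max (A : set R) (m : R) : Prop := A m /\ ubound A m.

Definition log2_order E M : nat := logn 2 #|'Gal(M / E)%g|.

Definition is_lower_break E M (i : nat) (l : R) : Prop :=
  is_max [set nu | 2 ^ ((log2_order E M).+1 - i) <= #|lower_group E M nu|]%N l.

Definition is_upper_break E M (i : nat) (u : R) : Prop :=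
  is_max [set nu | 2 ^ ((log2_order E M).+1 - i) <= #|upper_group E M nu|]%N u.

Definition conductor E M : R := xget 0 [set c | is_lower_break E M 1 c].

End Ramification.

(* Main.v *)
Require Import Defs.
From mathcomp Require Import zify ring.
Set Implicit Arguments.
Unset Strict Implicit.
Unset Printing Implicit Defensive.
Import Order.TTheory GRing.Theory Num.Theory.
Local Open Scope ring_scope.

(** Let v be the normalized valuation of L and p a uniformizer. Since L is totally
    ramified over K, the powers of p form a basis of L over K whose terms have distinct
    valuations; this gives, without using completeness, the invariance of v under the
    Galois group, the proportionality of v to the valuation of every intermediate field,
    and the fact that i(g) = v(g p - p) is the minimum of v(g x - x) over the integral x.

    An element g of the group is determined by g q - q, g s - s in {0, 1} and
    g r - r - (g q - q) s in {0, 1}, and all eight possibilities occur. Conjugation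
    shows that i takes the same value A, resp. B, C, on the two elements moving only q,
    resp. only s, both q and s, among q and s. The central involution is a product of
    two elements of each of these pairs, so i takes a value Z >= A, B, C on it. For a
    quadratic step E(y)/E with y^2 + y in E and v(y) odd and negative in the
    normalization of E(y), the conductor is -v(y), and by Serre's formula for quotients
    the sum of i over the nontrivial coset is determined by this conductor. Applied to
    K[q], K[s], K[q+s] over K and K[q,r] over K[q] this gives
      A + C = 2(c_q + 1), B + C = 2(c_s + 1), A + B = 2(c_{q+s} + 1),
      Z + B = 2(c_r + 1),
    whence the orders of all lower ramification groups. The upper breaks are the images
    of the lower ones under the strictly increasing Herbrand function. *)

Ltac int_lia := repeat match goal with
  | H : is_true (~~ (_ == ?x)) |- _ => lazymatch type of x with
    | int => fail | nat => fail | _ => clear H end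
  | H : is_true (_ \in _) |- _ => clear H
  end; lia.

(** * Valuations and expansions in powers of a uniformizer *)

Section Valuations.
Variables (K : fieldType) (L : fieldExtType K) (ord : K -> int).
Implicit Types (M N : {subfield L}) (v w : L -> int) (x y : L).

(** No normalization is imposed, so that the valuation of [L] restricts to every subfield with the
    same [e]; the values at 0 and outside [M] are unconstrained. *)
Definition val_over M (e : nat) v : Prop :=
  [/\ {in M &, forall x y, x != 0 -> y != 0 -> v (x * y) = v x + v y},
      {in M &, forall x y, x != 0 -> y != 0 -> x + y != 0 ->
        Num.min (v x) (v y) <= v (x + y)},
      (0 < e)%N &
      forall X : K, X != 0 -> v X%:A = ord X * e%:Z].

(* [v x >= m], with the convention [v 0 = +oo] *)
Definition vge v (m : int) x := (x == 0) || (m <= v x).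

Lemma vge0 v m : vge v m 0. Proof. by rewrite /vge eqxx. Qed.

Lemma vge_refl v x : vge v (v x) x. Proof. by rewrite /vge lexx orbT. Qed.

Lemma vgeE v m x : x != 0 -> vge v m x = (m <= v x).
Proof. by rewrite /vge => /negPf ->. Qed.

Lemma vge_le v m n x : m <= n -> vge v n x -> vge v m x.
Proof. by move=> mn /orP[/eqP->|nx]; rewrite ?vge0// /vge (le_trans mn nx) orbT. Qed.

Lemma val_overS M N e v : (M <= N)%VS -> val_over N e v -> val_over M e v.
Proof.
move=> /subvP MN [vM vD e0 vX]; split=> // x y /MN xN /MN yN; [exact: vM|exact: vD].
Qed.

Section Theory.
Variables (M : {subfield L}) (e : nat) (v : L -> int).
Hypothesis vM : val_over M e v.
Local Notation vge := (vge v).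

Lemma valM x y : x \in M -> y \in M -> x != 0 -> y != 0 -> v (x * y) = v x + v y.
Proof. by case: vM => + _ _ _; apply. Qed.

Lemma val_scalar X : X != 0 -> v X%:A = ord X * e%:Z.
Proof. by case: vM => _ _ _; apply. Qed.

Lemma val1 : v 1 = 0.
Proof.
have : v (1 * 1) = v 1 + v 1 by rewrite valM ?mem1v ?oner_neq0.
by rewrite mulr1; lia.
Qed.

Lemma valN x : x \in M -> v (- x) = v x.
Proof.
have [->|x0 xM] := eqVneq x 0; first by rewrite oppr0.
have N1M : -1 \in M by rewrite rpredN mem1v.
have N10 : -1 != 0 :> L by rewrite oppr_eq0 oner_neq0.
have : v (-1 * -1) = v (-1) + v (-1) by rewrite valM.
by rewrite mulrNN mulr1 val1 -[- x]mulN1r valM//; lia.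
Qed.

Lemma valV x : x \in M -> x != 0 -> v x^-1 = - v x.
Proof.
move=> xM x0; have : v (x * x^-1) = v x + v x^-1 by rewrite valM ?rpredVr ?invr_eq0.
by rewrite divff// val1; lia.
Qed.

Lemma valXn x n : x \in M -> x != 0 -> v (x ^+ n) = v x * n%:Z.
Proof.
move=> xM x0; elim: n => [|n IH]; first by rewrite expr0 val1 mulr0.
by rewrite exprS valM ?rpredX ?expf_neq0// IH; lia.
Qed.

Lemma valXz x (n : int) : x \in M -> x != 0 -> v (x ^ n) = v x * n.
Proof.
move=> xM x0; case: n => n; first exact: valXn.
rewrite NegzE -exprz_inv -exprnP valXn ?rpredVr ?invr_eq0// valV//; lia.
Qed.

Lemma rpredXz x (n : int) : x \in M -> x ^ n \in M.
Proof.
by move=> xM; case: n => n; rewrite ?NegzE -?exprz_inv -exprnP rpredX ?rpredVr.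
Qed.

Lemma val_prod (I : finType) (P : pred I) (F : I -> L) :
  (forall i, P i -> F i \in M /\ F i != 0) ->
  v (\prod_(i | P i) F i) = \sum_(i | P i) v (F i).
Proof.
move=> FM; pose Q x n := [/\ x \in M, x != 0 & v x = n].
suff [] : Q (\prod_(i | P i) F i) (\sum_(i | P i) v (F i)) by [].
apply: (big_ind2 Q) => [|x m y n [xM x0 <-] [yM y0 <-]|i /FM[]]//.
- by split; rewrite ?mem1v ?oner_neq0 ?val1.
- by split; rewrite ?rpredM ?mulf_neq0 ?valM.
Qed.

Lemma vgeD m x y : x \in M -> y \in M -> vge m x -> vge m y -> vge m (x + y).
Proof.
have [->|x0] := eqVneq x 0; first by move=> *; rewrite add0r.
have [->|y0] := eqVneq y 0; first by move=> *; rewrite addr0.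
have [->|xy0] := eqVneq (x + y) 0; first by rewrite vge0.
rewrite !vgeE// => xM yM mx my; case: vM => _ vD _ _.
by apply: le_trans (vD _ _ xM yM x0 y0 xy0); rewrite le_min mx.
Qed.

Lemma vgeN m x : x \in M -> vge m (- x) = vge m x.
Proof. by move=> xM; rewrite /vge oppr_eq0 valN. Qed.

Lemma vgeB m x y : x \in M -> y \in M -> vge m x -> vge m y -> vge m (x - y).
Proof. by move=> xM yM mx my; rewrite vgeD ?rpredN ?vgeN. Qed.

Lemma vgeM m n x y : x \in M -> y \in M -> vge m x -> vge n y -> vge (m + n) (x * y).
Proof.
have [->|x0] := eqVneq x 0; first by move=> *; rewrite mul0r vge0.
have [->|y0] := eqVneq y 0; first by move=> *; rewrite mulr0 vge0.
by move=> xM yM; rewrite !vgeE ?mulf_neq0// valM//; lia.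
Qed.

Lemma vge_sum m (I : finType) (P : pred I) (F : I -> L) :
  (forall i, P i -> F i \in M) -> (forall i, P i -> vge m (F i)) ->
  vge m (\sum_(i | P i) F i).
Proof.
move=> FM Fm; suff /andP[] : (\sum_(i | P i) F i \in M) && vge m (\sum_(i | P i) F i) by [].
apply: (big_ind (fun x => (x \in M) && vge m x)) => [|x y /andP[xM mx] /andP[yM my]|i Pi].
- by rewrite rpred0 vge0.
- by rewrite rpredD ?vgeD.
- by rewrite FM ?Fm.
Qed.

Lemma val_dominant x y : x \in M -> y \in M -> x != 0 -> vge (v x + 1) y ->
  x + y != 0 /\ v (x + y) = v x.
Proof.
move=> xM yM x0 xy; have nz : x + y != 0.
  apply/eqP => /eqP; rewrite addr_eq0 => /eqP xNy; move: xy x0.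
  by rewrite xNy valN// oppr_eq0 => /orP[->//|]; lia.
split=> //; have xyM : x + y \in M by rewrite rpredD.
have le1 : v x <= v (x + y).
  by rewrite -(vgeE _ _ nz) vgeD ?vge_refl//; apply: vge_le xy; lia.
have [le2|lt2] := leP (v (x + y)) (v x); first lia.
suff : vge (v x + 1) (x + y - y) by rewrite addrK vgeE//; lia.
by rewrite vgeB// vgeE//; lia.
Qed.

Lemma val_dominant_sum (I : finType) (F : I -> L) i :
  (forall j, F j \in M) -> F i != 0 -> (forall j, j != i -> vge (v (F i) + 1) (F j)) ->
  \sum_j F j != 0 /\ v (\sum_j F j) = v (F i).
Proof.
move=> FM Fi0 dom; rewrite (bigD1 i)//=; apply: val_dominant => //.
  by rewrite rpred_sum.
exact: vge_sum.
Qed.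

(** Terms of incongruent valuations cannot cancel, so a lower bound for the sum passes to each
    summand. *)
Lemma vge_split (m n : int) x y : x \in M -> y \in M ->
  (x != 0 -> y != 0 -> ~~ (m %| (v x - v y)%R)%Z) -> vge n (x + y) -> vge n x /\ vge n y.
Proof.
move=> xM yM ndvd nxy.
have [x0|x0] := eqVneq x 0; first by split; [rewrite x0 vge0|move: nxy; rewrite x0 add0r].
have [y0|y0] := eqVneq y 0; first by split; [move: nxy; rewrite y0 addr0|rewrite y0 vge0].
rewrite !(vgeE _ _ x0, vgeE _ _ y0); move: (ndvd x0 y0) => {}ndvd.
have [lt_xy|lt_yx|eq_xy] := ltgtP (v x) (v y); last by rewrite eq_xy subrr dvdz0 in ndvd.
- have [nz e_xy] : x + y != 0 /\ v (x + y) = v x by apply: val_dominant; rewrite // vgeE//; lia.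
  by move: nxy; rewrite vgeE// e_xy; split=> //; lia.
- have [nz e_yx] : y + x != 0 /\ v (y + x) = v y by apply: val_dominant; rewrite // vgeE//; lia.
  by move: nxy; rewrite addrC vgeE// e_yx; split=> //; lia.
Qed.

End Theory.

(** * Expansions over [K] in powers of a uniformizer [b] of [M], where [v] is [c] times the
    normalized valuation *)

Section Expansion.
Variables (M : {subfield L}) (e c : nat) (v : L -> int) (b : L).
Hypotheses (vM : val_over M e v) (bM : b \in M) (b0 : b != 0) (vb : v b = c%:Z).
Hypothesis (ecM : e = (c * \dim M)%N).
Local Notation n := (\dim M).
Implicit Types (a : 'I_n -> K).

Let c_gt0 : (0 < c)%N.
Proof. by case: vM => _ _ + _; rewrite ecM muln_gt0 => /andP[]. Qed.

Lemma expansion_mem a i : a i *: b ^+ i \in M.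
Proof. by rewrite rpredZ ?rpredX. Qed.

Lemma val_term a i : a i != 0 ->
  v (a i *: b ^+ i) = c%:Z * (ord (a i) * n%:Z + i%:Z).
Proof.
move=> ai0; have sM : (a i)%:A \in M by rewrite rpredZ ?mem1v.
have s0 : (a i)%:A != 0 :> L by rewrite scaler_eq0 negb_or ai0 oner_neq0.
rewrite -mulr_algl (valM vM) ?rpredX ?expf_neq0// (valXn vM)// (val_scalar vM)//.
by rewrite vb ecM; lia.
Qed.

(* The terms have distinct valuations, as these are distinct modulo [e]. *)
Lemma expansion_dominant a i : a i != 0 ->
  exists j, [/\ a j != 0, \sum_i a i *: b ^+ i != 0,
    v (\sum_i a i *: b ^+ i) = v (a j *: b ^+ j) &
    forall l, vge v (v (a j *: b ^+ j)) (a l *: b ^+ l)].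
Proof.
move=> ai0; case: (@Order.TotalTheory.arg_minP _ _ _ i (fun j => a j != 0)
  (fun j => v (a j *: b ^+ j)) ai0) => j aj0 jmin.
have dom l : l != j -> vge v (v (a j *: b ^+ j) + 1) (a l *: b ^+ l).
  move=> lj; have [->|al0] := eqVneq (a l) 0; first by rewrite scale0r vge0.
  rewrite vgeE ?scaler_eq0 ?negb_or ?al0 ?expf_neq0//.
  have := jmin l al0; rewrite !val_term//.
  suff : ord (a j) * n%:Z + j%:Z <> ord (a l) * n%:Z + l%:Z.
    have := c_gt0; nia.
  have /eqP jl : (l : nat) != j by [].
  have := ltn_ord l; have := ltn_ord j; case: (ltgtP (ord (a j)) (ord (a l))) => [||->]; nia.
have j0 : a j *: b ^+ j != 0 by rewrite scaler_eq0 negb_or aj0 expf_neq0.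
have [sum0 vsum] := val_dominant_sum vM (expansion_mem a) j0 dom.
exists j; split=> // l; have [->|lj] := eqVneq l j; first exact: vge_refl.
by apply: vge_le (dom l lj); lia.
Qed.

(** A nontrivial combination of the powers has a dominant term, hence is nonzero; so these [n]
    powers are free, and form a basis. *)
Lemma expansion x : x \in M -> exists a, x = \sum_i a i *: b ^+ i.
Proof.
pose X := [tuple b ^+ i | i < n].
have nthX (i : 'I_n) : X`_i = b ^+ i by rewrite -tnth_nth tnth_mktuple.
have freeX : free X.
  apply/freeP => a; under eq_bigr => i _ do rewrite nthX.
  move=> /eqP sum0 i; apply: contraTeq sum0 => ai0.
  by have [j []] := expansion_dominant ai0.
have basisX : basis_of M X.
  rewrite basisEfree freeX size_tuple leqnn andbT; apply/span_subvP => y.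
  by move=> /mapP[i _ ->]; rewrite rpredX.
move=> xM; exists (fun i => coord X i x).
rewrite {1}(coord_basis basisX xM); apply: eq_bigr => i _.
by rewrite nthX.
Qed.

Lemma expansionP x : x \in M -> x != 0 -> exists a j,
  [/\ x = \sum_i a i *: b ^+ i, a j != 0, v x = v (a j *: b ^+ j) &
    forall l, vge v (v x) (a l *: b ^+ l)].
Proof.
move=> xM x0; have [a xE] := expansion xM.
have [i ai0] : exists i, a i != 0.
  apply/existsP; apply: contraNT x0; rewrite negb_exists => /forallP a0.
  by rewrite xE big1// => i _; have:= a0 i; rewrite negbK => /eqP->; rewrite scale0r.
have [j [aj0 _ vE jmin]] := expansion_dominant ai0.
by exists a, j; split=> //; rewrite xE vE.
Qed.

Lemma dvdz_val x : x \in M -> x != 0 -> (c %| v x)%Z.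
Proof.
by move=> xM x0; have [a [j [_ aj0 -> _]]] := expansionP xM x0; rewrite val_term ?dvdz_mulr.
Qed.

(** No term has smaller valuation than [x], and [ord (a i) * n + i >= 0] with [i < n] forces
    [ord (a i) >= 0]. *)
Lemma expansion_integral x : x \in M -> vge v 0 x ->
  exists2 a : 'I_n -> K, x = \sum_i a i *: b ^+ i & forall i, a i != 0 -> 0 <= ord (a i).
Proof.
move=> xM; have [->|x0] := eqVneq x 0.
  exists (fun=> 0) => [|i]; last by rewrite eqxx.
  by rewrite big1// => i _; rewrite scale0r.
have [a [j [xE aj0 vE jmin]]] := expansionP xM x0.
rewrite vgeE// => v0; exists a => // i ai0; have := jmin i.
rewrite vgeE ?scaler_eq0 ?negb_or ?ai0 ?expf_neq0// val_term// => le_i.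
have := ltn_ord i; have := c_gt0; nia.
Qed.

(** The residue extension is trivial: in the expansion of a unit every term but the constant one has
    positive valuation. *)
Lemma residue x : x \in M -> v x = 0 -> exists X : K, vge v 1 (x - X%:A).
Proof.
have [->|x0 xM vx0] := eqVneq x 0; first by exists 0; rewrite scale0r subr0 vge0.
have [a [j [xE aj0 vE jmin]]] := expansionP xM x0.
pose i0 : 'I_n := Ordinal (adim_gt0 M); exists (a i0).
rewrite xE (bigD1 i0)//= expr0 addrAC subrr add0r.
apply: (vge_sum vM) => i ii0; first exact: expansion_mem.
have [->|ai0] := eqVneq (a i) 0; first by rewrite scale0r vge0.
have := jmin i; rewrite vx0 !vgeE ?scaler_eq0 ?negb_or ?ai0 ?expf_neq0//.
have /eqP ni0 : (i : nat) != 0 by [].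
rewrite val_term// pmulr_rge0 ?ltz_nat ?c_gt0// => ge0.
have ord_ge0 : 0 <= ord (a i) by have := ltn_ord i; nia.
have := c_gt0; nia.
Qed.

Section Uniqueness.
Variables (e' : nat) (w : L -> int) (t : K).
Hypotheses (wM : val_over M e' w) (t0 : t != 0) (ord_t : ord t = 1).

(** [b ^+ n] is a combination of lower powers of [b] with integral coefficients; if [w b] were
    negative, [b ^+ n] would have smaller valuation than all of them. *)
Lemma val_uniform_ge0 : 0 <= w b.
Proof.
have bn0 : b ^+ n != 0 by rewrite expf_neq0.
have bnM : b ^+ n \in M by rewrite rpredX.
have [|a bnE a_ge0] := expansion_integral bnM.
  by rewrite vgeE// (valXn vM)// vb; lia.
rewrite leNgt; apply/negP => wb_lt0.
have : vge w (w b * (n%:Z - 1)) (b ^+ n).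
  rewrite bnE; apply: (vge_sum wM) => i _; first exact: expansion_mem.
  have [->|ai0] := eqVneq (a i) 0; first by rewrite scale0r vge0.
  rewrite vgeE ?scaler_eq0 ?negb_or ?ai0 ?expf_neq0//.
  rewrite -mulr_algl (valM wM) ?rpredX ?expf_neq0 ?rpredZ ?mem1v//; last first.
    by rewrite scaler_eq0 negb_or ai0 oner_neq0.
  rewrite (valXn wM)// (val_scalar wM)//.
  have := a_ge0 i ai0; have := ltn_ord i; nia.
by rewrite vgeE// (valXn wM)//; nia.
Qed.

Lemma val_ge0_transfer x : x \in M -> vge v 0 x -> vge w 0 x.
Proof.
move=> xM /(expansion_integral xM)[a -> a_ge0].
apply: (vge_sum wM) => i _; first exact: expansion_mem.
have [->|ai0] := eqVneq (a i) 0; first by rewrite scale0r vge0.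
rewrite vgeE ?scaler_eq0 ?negb_or ?ai0 ?expf_neq0//.
rewrite -mulr_algl (valM wM) ?rpredX ?expf_neq0 ?rpredZ ?mem1v//; last first.
  by rewrite scaler_eq0 negb_or ai0 oner_neq0.
rewrite (valXn wM)// (val_scalar wM)//.
by have := a_ge0 i ai0; have := val_uniform_ge0; nia.
Qed.

(** A power of [t] turns [x ^+ e] into a unit [y] for [v]. Integrality of [y] and of its inverse
    transfers to [w], so [w y = 0]. *)
Lemma val_unique x : x \in M -> x != 0 -> e%:Z * w x = e'%:Z * v x.
Proof.
move=> xM x0; pose tL : L := t%:A; pose y := x ^+ e * tL ^ (- v x).
have tM : tL \in M by rewrite rpredZ ?mem1v.
have tL0 : tL != 0 by rewrite scaler_eq0 negb_or t0 oner_neq0.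
have txM : tL ^ (- v x) \in M by apply: rpredXz.
have tx0 : tL ^ (- v x) != 0 by rewrite expfz_neq0.
have yM : y \in M by rewrite rpredM ?rpredX.
have y0 : y != 0 by rewrite mulf_neq0 ?expf_neq0.
have vy : v y = 0.
  rewrite (valM vM) ?rpredX ?expf_neq0// (valXn vM)// (valXz vM)//.
  by rewrite (val_scalar vM)// ord_t; int_lia.
have wy : w y = e%:Z * w x - e'%:Z * v x.
  rewrite (valM wM) ?rpredX ?expf_neq0// (valXn wM)// (valXz wM)//.
  by rewrite (val_scalar wM)// ord_t; int_lia.
have := val_ge0_transfer yM; rewrite !vgeE// vy => /(_ isT).
have := val_ge0_transfer (rpredVr yM); rewrite !vgeE ?invr_eq0//.
by rewrite (valV vM)// (valV wM)// vy wy => /(_ isT); int_lia.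
Qed.

End Uniqueness.
End Expansion.
End Valuations.

(** * Ramification in totally ramified Galois extensions *)

Section TotallyRamified.
Variables (K : fieldType) (L : splittingFieldType K) (ord : K -> int).
Variables (v : L -> int) (t : K) (p : L).
Hypotheses (vL : val_over ord {:L} (\dim {:L}) v).
Hypotheses (t0 : t != 0) (ord_t : ord t = 1) (p0 : p != 0) (vp : v p = 1).
Local Notation N M := ('Gal({:L} / M)%g).
Implicit Types (M E : {subfield L}) (s : gal_of {:L}).

Let dimL : \dim {:L} = (1 * \dim {:L})%N. Proof. by rewrite mul1n. Qed.

Lemma gal_scalar s (X : K) : s X%:A = X%:A.
Proof. by rewrite linearZ rmorph1. Qed.

(** [v \o s] extends [ord] with the same ramification index as [v], so the uniqueness of extensions
    identifies the two. *)
Lemma val_gal s (x : L) : x != 0 -> v (s x) = v x.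
Proof.
have vsL : val_over ord {:L} (\dim {:L}) (v \o s).
  split=> [x1 x2 _ _ x10 x20|x1 x2 _ _ x10 x20 x12||X X0] /=.
  - by rewrite rmorphM (valM vL) ?memvf ?fmorph_eq0.
  - rewrite rmorphD; case: vL => _ vD _ _; apply: vD; rewrite ?memvf ?fmorph_eq0//.
    by rewrite -rmorphD fmorph_eq0.
  - exact: adim_gt0.
  - by rewrite gal_scalar (val_scalar vL).
move=> x0; apply: (@mulfI _ (\dim {:L})%:Z).
  by have := adim_gt0 {:L}%AS; case: (\dim _).
exact: (val_unique vL (memvf p) p0 vp dimL vsL t0 ord_t (memvf x) x0).
Qed.

Lemma vge_gal s m (x : L) : vge v m (s x) = vge v m x.
Proof.
have [->|x0] := eqVneq x 0; first by rewrite rmorph0.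
by rewrite !vgeE ?fmorph_eq0// val_gal.
Qed.

(** Expand [x] in powers of [p] with integral coefficients: [s p - p] divides each
    [s p ^+ i - p ^+ i] with an integral quotient. *)
Lemma iG_min s x : vge v 0 x -> vge v (v (s p - p)) (s x - x).
Proof.
move=> /(expansion_integral vL (memvf p) p0 vp dimL (memvf x))[a -> a_ge0].
rewrite linear_sum -sumrB; apply: (vge_sum vL) => i _; first by rewrite memvf.
have [->|ai0] := eqVneq (a i) 0; first by rewrite !scale0r rmorph0 subr0 vge0.
rewrite linearZ -scalerBr rmorphXn subrXX -mulr_algl -[X in vge v X _]add0r.
have vge_p j : vge v 0 (p ^+ j) by rewrite vgeE ?expf_neq0// (valXn vL) ?memvf// vp; lia.
have vge_sp j : vge v 0 (s p ^+ j) by rewrite -rmorphXn vge_gal.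
rewrite (vgeM vL) ?memvf//.
  rewrite vgeE ?scaler_eq0 ?negb_or ?ai0 ?oner_neq0// (val_scalar vL)//.
  by have := a_ge0 i ai0; lia.
rewrite -[X in vge v X _]addr0 (vgeM vL) ?memvf ?vge_refl//.
apply: (vge_sum vL) => j _; first by rewrite memvf.
by rewrite -[X in vge v X _]addr0 (vgeM vL) ?memvf.
Qed.

Hypothesis (galL : galois 1 {:L}).

Lemma card_gal_dim M : (#|N M| * \dim M = \dim {:L})%N.
Proof.
have galM : galois M {:L} by apply: galoisS galL; rewrite sub1v subvf.
by rewrite -galois_dim// divnK// field_dimS// subvf.
Qed.

(** The norm of [p] from [L] to [M]. By Galois invariance its valuation is the ramification index of
    [L] over [M]. *)
Definition uniformizer M : L := \prod_(s in N M) s p.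

Lemma mem_uniformizer M : uniformizer M \in M.
Proof.
by apply: mem_galNorm; rewrite ?memvf//; apply: galoisS galL; rewrite sub1v subvf.
Qed.

Lemma uniformizer_neq0 M : uniformizer M != 0.
Proof. by apply/prodf_neq0 => s _; rewrite fmorph_eq0. Qed.

Lemma val_uniformizer M : v (uniformizer M) = #|N M|%:Z.
Proof.
rewrite (val_prod vL) => [|s _]; last by rewrite memvf fmorph_eq0.
under eq_bigr => s _ do rewrite val_gal// vp.
by rewrite sumr_const; lia.
Qed.

Lemma val_overM M : val_over ord M (\dim {:L}) v.
Proof. exact: val_overS (subvf M) vL. Qed.

Lemma dvdz_card_gal_val M x : x \in M -> x != 0 -> (#|N M| %| v x)%Z.
Proof.
apply: (dvdz_val (val_overM M) (mem_uniformizer M) (uniformizer_neq0 M)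
  (val_uniformizer M)).
by rewrite card_gal_dim.
Qed.

Lemma val_over_proportional M e' w : val_over ord M e' w ->
  forall x, x \in M -> x != 0 -> (\dim {:L})%:Z * w x = e'%:Z * v x.
Proof.
move=> wM x xM x0.
apply: (val_unique (val_overM M) (mem_uniformizer M) (uniformizer_neq0 M)
  (val_uniformizer M) _ wM t0 ord_t xM x0).
by rewrite card_gal_dim.
Qed.

Lemma residue_field x : v x = 0 -> exists X : K, vge v 1 (x - X%:A).
Proof. exact: (residue vL (memvf p) p0 vp dimL (memvf x)). Qed.

End TotallyRamified.

(** * The function [iG]: independence of the uniformizer, conjugation, products, sums over cosets *)

Section RamificationFunction.
Variables (K : fieldType) (L : splittingFieldType K) (ord : K -> int).
Variables (v : L -> int) (t : K) (p : L).
Hypotheses (vL : val_over ord {:L} (\dim {:L}) v).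
Hypotheses (t0 : t != 0) (ord_t : ord t = 1) (p0 : p != 0) (vp : v p = 1).
Local Notation N M := ('Gal({:L} / M)%g).
Implicit Types (M E : {subfield L}) (s x y : gal_of {:L}).

(* The function [i_G] of Serre's Local Fields, IV.1, with a junk value at the
   identity. *)
Definition iG s : int := v (s p - p).

Lemma gal_fix_uniformizer s : (s p == p) = (s == 1%g).
Proof.
apply/eqP/eqP => [sp|->]; last by rewrite gal_id.
apply/eqP/gal_eqP => a aL; rewrite gal_id.
have [c ->] := expansion vL (memvf p) p0 vp (esym (mul1n _)) aL.
by rewrite linear_sum; apply: eq_bigr => i _; rewrite linearZ rmorphXn /= sp.
Qed.

Lemma sub_gal_neq0 s : (s p - p != 0) = (s != 1%g).
Proof. by rewrite subr_eq0 gal_fix_uniformizer. Qed.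

(** Two uniformizers bound each other through [iG_min]. *)
Lemma iG_uniformizer s a : s != 1%g -> a != 0 -> v a = 1 -> v (s a - a) = iG s.
Proof.
move=> s1 a0 va; have sp0 := s1; rewrite -sub_gal_neq0 in sp0.
have ge_pa : vge v (iG s) (s a - a).
  by apply: (iG_min vL t0 ord_t p0 vp); rewrite vgeE// va.
have ge_ap : vge v (v (s a - a)) (s p - p).
  by apply: (iG_min vL t0 ord_t a0 va); rewrite vgeE// vp.
have sa0 : s a - a != 0.
  rewrite subr_eq0; apply: contraNneq s1 => sa; apply/eqP/eqP/gal_eqP => b bL.
  rewrite gal_id; have [c ->] := expansion vL (memvf a) a0 va (esym (mul1n _)) bL.
  by rewrite linear_sum; apply: eq_bigr => i _; rewrite linearZ rmorphXn /= sa.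
by move: ge_pa ge_ap; rewrite !vgeE// /iG; lia.
Qed.

(** Computed with the uniformizer [s p]: products act from left to right, so
    [x (s p) - s p = s (y p - p)]. *)
Lemma iG_conj s x y : x != 1%g -> (s * x = y * s)%g -> iG x = iG y.
Proof.
move=> x1 sxys; rewrite -(@iG_uniformizer x (s p))// ?fmorph_eq0 ?(val_gal vL t0 ord_t p0 vp)//.
rewrite -galM ?memvf// sxys galM ?memvf// -rmorphB (val_gal vL t0 ord_t p0 vp)//.
rewrite sub_gal_neq0; apply: contraNneq x1 => y1; move: sxys; rewrite y1 mul1g.
by rewrite -{2}[s]mulg1 => /mulgI ->.
Qed.

(** Write [(x * y) p - p] as [y (x p - p) + (y p - p)]. *)
Lemma iG_mul x y : x != 1%g -> y != 1%g -> (x * y != 1)%g ->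
  Num.min (iG x) (iG y) <= iG (x * y)%g.
Proof.
move=> x1 y1 xy1; have := xy1; rewrite -sub_gal_neq0 => xyp0.
have xp0 := x1; rewrite -sub_gal_neq0 in xp0; have yp0 := y1; rewrite -sub_gal_neq0 in yp0.
rewrite -(vgeE _ _ xyp0) galM ?memvf// -(subrK (y p) (y (x p))) -addrA -rmorphB.
apply: (vgeD vL); rewrite ?memvf// vgeE ?fmorph_eq0//
  ?(val_gal vL t0 ord_t p0 vp)// ge_min lexx ?orbT//.
Qed.

Definition vge_poly (f : {poly L}) := forall i, vge v 0 f`_i.

Lemma vge_polyM f g : vge_poly f -> vge_poly g -> vge_poly (f * g).
Proof.
move=> f0 g0 i; rewrite coefM; apply: (vge_sum vL) => j _; first by rewrite memvf.
by rewrite -[X in vge v X _]addr0; apply: (vgeM vL); rewrite ?memvf.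
Qed.

Section Coset.
Hypothesis (galL : galois 1 {:L}).
Variables (M : {subfield L}) (s : gal_of {:L}) (m : int).
Hypothesis s_int : forall a, a \in M -> vge v 0 a -> vge v m (s a - a).
Hypothesis s_unif : forall a, a \in M -> a != 0 -> v a = #|N M|%:Z ->
  s a - a != 0 /\ v (s a - a) = m.

Let f : {poly L} := \prod_(r in N M) ('X - (r p)%:P).

Let map_f x : map_poly x f = \prod_(r in N M) ('X - ((r * x)%g p)%:P).
Proof.
rewrite rmorph_prod; apply: eq_bigr => r _ /=.
by rewrite rmorphB /= map_polyX map_polyC /= galM ?memvf.
Qed.

Let f_over i : f`_i \in M.
Proof.
have galM : galois M {:L} by apply: galoisS galL; rewrite sub1v subvf.
rewrite -(galois_fixedField galM); apply/fixedFieldP => [|x xN]; first exact: memvf.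
rewrite -coef_map map_f (reindex_inj (mulIg x^-1)%g)/=; congr (_`_i).
under eq_bigl => r do rewrite groupMr ?groupV//.
by under eq_bigr => r _ do rewrite mulgKV.
Qed.

Let f_int : vge_poly f.
Proof.
apply: (big_ind vge_poly) => [i||r _ i].
- by rewrite coef1; case: (i == 0)%N; rewrite ?vge0// vgeE ?oner_neq0 ?(val1 vL).
- exact: vge_polyM.
rewrite coefB coefX coefC; apply: (vgeB vL); rewrite ?memvf//.
- by case: (i == 1)%N; rewrite ?vge0// vgeE ?oner_neq0 ?(val1 vL).
- by case: (i == 0)%N; rewrite ?vge0// vgeE ?fmorph_eq0// (val_gal vL t0 ord_t p0 vp)// vp.
Qed.

(* Serre, Local Fields, IV.1, Proposition 3: the value at [p] of [s f - f], with
   [f] the minimal polynomial of [p] over [M], has the valuation of its constant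
   coefficient [s b - b], where [b] is a uniformizer of [M]. *)
Lemma sum_iG_coset : \sum_(r in N M) iG (r * s)%g = m.
Proof.
have f0E : f`_0 = \prod_(r in N M) - r p.
  rewrite -horner_coef0 horner_prod; apply: eq_bigr => r _.
  by rewrite hornerXsubC sub0r.
have f00 : f`_0 != 0.
  by rewrite f0E; apply/prodf_neq0 => r _; rewrite oppr_eq0 fmorph_eq0.
have vf0 : v f`_0 = #|N M|%:Z.
  rewrite f0E (val_prod vL) => [|r _]; last by rewrite memvf oppr_eq0 fmorph_eq0.
  under eq_bigr => r _ do rewrite (valN vL) ?memvf// (val_gal vL t0 ord_t p0 vp)// vp.
  by rewrite sumr_const; lia.
have [sf00 vsf0] := s_unif (f_over 0) f00 vf0.
pose g := map_poly s f - f; have gE i : g`_i = s f`_i - f`_i by rewrite coefB coef_map.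
(* The factor of [f] at the identity vanishes at [p], so only the conjugate of [f] by [s]
   contributes. *)
have gp : g.[p] = \prod_(r in N M) (p - (r * s)%g p).
  rewrite hornerD hornerN map_f !horner_prod [X in _ - X](bigD1 1%g)//=.
  rewrite hornerXsubC gal_id subrr mul0r subr0.
  by apply: eq_bigr => r _; rewrite hornerXsubC.
have [gp0 vgp] : g.[p] != 0 /\ v g.[p] = m.
  have lt0 : (0 < size g)%N.
    by rewrite size_poly_gt0; apply: contraNneq sf00 => g0; rewrite -gE g0 coef0.
  rewrite horner_coef; case: (size g) lt0 => // n _.
  rewrite big_ord_recl expr0 mulr1 gE -vsf0; apply: (val_dominant vL); rewrite ?memvf//.
  (* A term of positive degree has valuation at least [m + 1]: its coefficient contributes [m] by
     [s_int], and the power of [p] at least 1. *)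
  apply: (vge_sum vL) => i _; first by rewrite memvf.
  rewrite gE vsf0; apply: (vgeM vL); rewrite ?memvf//.
    by apply: s_int; [apply: f_over|apply: f_int].
  by rewrite vgeE ?expf_neq0// (valXn vL) ?memvf// vp lift0; lia.
have fac0 r : r \in N M -> p - (r * s)%g p != 0.
  by move=> rN; apply: contraNneq gp0 => h; rewrite gp (bigD1 r)//= h mul0r.
rewrite -vgp gp (val_prod vL) => [|r rN]; last by rewrite memvf fac0.
by apply: eq_bigr => r _; rewrite -opprB (valN vL) ?memvf.
Qed.

End Coset.
End RamificationFunction.

(** * Quadratic steps in characteristic two *)

Lemma Artin_Schreier_roots (L : fieldType) (y z : L) : 2%N \in [pchar L] ->
  z ^+ 2 + z = y ^+ 2 + y -> z = y \/ z = y + 1.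
Proof.
move=> char2 zy; have /eqP : (z - y) * (z - (y + 1)) = 0.
  have y2 : 2 * y = 0 by rewrite -[2]/(2%:R) pcharf0 ?mul0r.
  have z2 : 2 * z = 0 by rewrite -[2]/(2%:R) pcharf0 ?mul0r.
  transitivity ((z ^+ 2 + z) - (y ^+ 2 + y) - (2 * z) * (y + 1) + 2 * y * (y + 1)).
    by ring.
  by rewrite zy y2 z2; ring.
by rewrite mulf_eq0 !subr_eq0 => /orP[] /eqP; [left|right].
Qed.

Section ArtinSchreierAdjoin.
Variables (K : fieldType) (L : splittingFieldType K) (E : {subfield L}) (y : L).
Hypothesis yE : y ^+ 2 + y \in E.

Lemma Artin_Schreier_decomp x : x \in <<E; y>>%VS ->
  exists a b, [/\ a \in E, b \in E & x = a + b * y].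
Proof.
case/Fadjoin_polyP => f fE ->; pose m : {poly L} := 'X^2 + 'X - (y ^+ 2 + y)%:P.
have mE : m \is a polyOver E by rewrite rpredB ?rpredD ?rpredX ?polyOverX ?polyOverC.
have size_m : size m = 3%N.
  rewrite /m -addrA size_polyDl ?size_polyXn// ltnS.
  rewrite (leq_trans (size_polyD _ _))// geq_max size_polyX size_polyN size_polyC.
  by case: (_ != 0).
have my : m.[y] = 0 by rewrite !hornerE subrr.
have rE := modp_polyOver fE mE; pose r := f %% m.
exists r`_0, r`_1; split; try exact/polyOverP.
have size_r : (size r <= 2)%N by rewrite -ltnS -size_m ltn_modp -size_poly_gt0 size_m.
rewrite (divp_eq f m) hornerD hornerM my mulr0 add0r -/r.
by rewrite (horner_coef_wide _ size_r) !big_ord_recr big_ord0 /= add0r expr0 mulr1 expr1.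
Qed.

Hypothesis char2 : 2%N \in [pchar L].

Lemma galois_Artin_Schreier : galois E <<E; y>>.
Proof.
apply/splitting_galoisField; pose f : {poly L} := 'X^2 + 'X - (y ^+ 2 + y)%:P.
have fE : f = \prod_(z <- [:: y; y + 1]) ('X - z%:P).
  have two0 : 2 = 0 :> {poly L} by rewrite -[2](rmorph_nat (@polyC L)) pcharf0.
  rewrite big_cons big_seq1 /f !rmorphD rmorphXn /= polyC1.
  transitivity (('X - y%:P) * ('X - (y%:P + 1)) +
    2 * (y%:P * 'X + 'X - y%:P ^+ 2 - y%:P)); first by ring.
  by rewrite two0 mul0r addr0.
exists f; split.
- by rewrite rpredB ?rpredD ?rpredX ?polyOverX ?polyOverC.
- rewrite fE separable_prod_XsubC /= inE andbT eq_sym -subr_eq0 addrAC subrr add0r.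
  exact: oner_neq0.
exists [:: y; y + 1]; first by rewrite fE eqpxx.
apply/eqP; rewrite eqEsubv; apply/andP; split.
  apply/Fadjoin_seqP; split=> [|z]; first exact: subv_adjoin.
  rewrite !inE => /orP[] /eqP->; rewrite ?rpredD ?memv_adjoin//.
  exact: (subvP (subv_adjoin E y)) (mem1v E).
apply/FadjoinP; split; first exact: subv_adjoin_seq.
by apply: seqv_sub_adjoin; rewrite inE eqxx.
Qed.

End ArtinSchreierAdjoin.

Section ArtinSchreierValuation.
Variables (K : fieldType) (L : splittingFieldType K) (ord : K -> int).
Variables (v : L -> int) (t : K) (p : L).
Hypotheses (galL : galois 1 {:L}) (vL : val_over ord {:L} (\dim {:L}) v).
Hypotheses (t0 : t != 0) (ord_t : ord t = 1) (p0 : p != 0) (vp : v p = 1).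
Local Notation N M := ('Gal({:L} / M)%g).
Variables (E M : {subfield L}) (y : L).
Variable m : nat.
Hypotheses (cardM : #|N M| = m) (cardE : #|N E| = (2 * m)%N).

Section Odd.
Variables (c : int) (a b : L).
Hypotheses (c_odd : ~~ (2 %| c)%Z) (y0 : y != 0) (vy : v y = - c * m%:Z).
Hypotheses (aE : a \in E) (bE : b \in E).

Let even_val x : x \in E -> x != 0 -> exists j, v x = 2 * j * m%:Z.
Proof.
move=> xE x0; have := dvdz_card_gal_val vL t0 ord_t p0 vp galL xE x0.
by move=> /dvdzP[j ->]; exists j; rewrite cardE; int_lia.
Qed.

Let cardM_gt0 : (0 < m)%N. Proof. by rewrite -cardM cardG_gt0. Qed.

Let vby : b != 0 -> v (b * y) = v b - c * m%:Z.
Proof. by move=> b0; rewrite (valM vL) ?memvf// vy; int_lia. Qed.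

(** In units of [m], nonzero elements of [E] have even valuation, whereas that of [y] is the odd
    number [- c]. *)
Let ndvd : a != 0 -> b * y != 0 ->
  ~~ (2 * m%:Z %| (v a - v (b * y))%R)%Z.
Proof.
move=> a0; rewrite mulf_eq0 negb_or => /andP[b0 _]; rewrite vby//.
have [i ->] := even_val aE a0; have [j ->] := even_val bE b0.
apply: contra c_odd => /dvdzP[l le]; apply/dvdzP; exists (l - i + j).
have M0 : m%:Z != 0 by have := cardM_gt0; case: m.
by apply: (mulIf M0); int_lia.
Qed.

(** If [s] fixes [E] and [s y = y + 1], then [b] is the displacement of [a + b * y] under [s].
    Integrality of [b * y] gives [v b >= c * m]; the gain to [c + 1] comes from parity. *)
Lemma vge_Artin_Schreier : vge v 0 (a + b * y) -> vge v ((c + 1) * m%:Z) b.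
Proof.
move=> /(vge_split vL (memvf a) (memvf _) ndvd)[_].
have [->|b0] := eqVneq b 0; first by rewrite vge0.
rewrite !vgeE ?mulf_neq0// vby//; have [j ->] := even_val bE b0.
have := cardM_gt0; move: c_odd => c_odd' M_gt0 ge0.
have : 0 <= (2 * j - c) * m%:Z by int_lia.
rewrite pmulr_lge0 ?ltz_nat// => ge0'.
by rewrite ler_pM2r ?ltz_nat//; int_lia.
Qed.

(** In units of [m] the valuation 1 is odd, so it can only come from the term [b * y]. *)
Lemma val_Artin_Schreier : a + b * y != 0 -> v (a + b * y) = m%:Z ->
  b != 0 /\ v b = (c + 1) * m%:Z.
Proof.
have M_gt0 := cardM_gt0; have M0 : m%:Z != 0 by case: m M_gt0.
have absurd j : 2 * j * m%:Z <> m%:Z.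
  by rewrite -[X in _ = X]mul1r => /(mulIf M0); int_lia.
have [->|b0] := eqVneq b 0.
  by rewrite mul0r addr0 => a0; have [j ->] := even_val aE a0 => /absurd.
move=> _; have by0 : b * y != 0 by rewrite mulf_neq0.
have [->|a0] := eqVneq a 0; first by rewrite add0r vby// => vb; split=> //; int_lia.
have [lt_ab|lt_ba|eq_ab] := ltgtP (v a) (v (b * y)).
- have [|_ ->] := @val_dominant _ _ _ _ _ _ vL a (b * y) (memvf _) (memvf _) a0.
    by rewrite vgeE//; int_lia.
  by have [j ->] := even_val aE a0 => /absurd.
- have [|_] := @val_dominant _ _ _ _ _ _ vL (b * y) a (memvf _) (memvf _) by0.
    by rewrite vgeE//; int_lia.
  by rewrite addrC => ->; rewrite vby// => vb; split=> //; int_lia.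
- by have := ndvd a0 by0; rewrite eq_ab subrr dvdz0.
Qed.

End Odd.

(* Take [y + b] of maximal valuation: if the latter were even in the normalization
   of [M], or zero, it could be increased, the residue fields being equal; and it is not
   positive, for then [1 = s (y + b) - (y + b)] would have positive valuation. *)
Lemma Artin_Schreier_odd (EM : (E <= M)%VS) (yM : y \in M)
    (s : gal_of {:L}) : s \in N E -> s y = y + 1 ->
  exists b c, [/\ b \in E, y + b != 0, ~~ (2 %| c)%Z & v (y + b) = - c * m%:Z].
Proof.
move=> sE sy; have M_gt0 : (0 < m)%N by rewrite -cardM cardG_gt0.
have syb b : b \in E -> s (y + b) = y + b + 1.
  by move=> bE; rewrite rmorphD /= sy (fixed_gal (subvf E) sE bE) addrAC.
have nvge1 b : b \in E -> ~~ vge v 1 (y + b).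
  move=> bE; apply/negP => h; have : vge v 1 (s (y + b) - (y + b)).
    by rewrite (vgeB vL) ?memvf// (vge_gal vL t0 ord_t p0 vp).
  by rewrite syb// addrAC subrr add0r vgeE ?oner_neq0// (val1 vL).
have yb0 b : b \in E -> y + b != 0.
  by move=> /nvge1; apply: contraNneq => ->; rewrite vge0.
(* Induction on a bound [n] for the distance of [v (y + b)] below 1; [n = 0] is excluded by
   [nvge1]. *)
suff main (n : nat) b : b \in E -> 1 - n%:Z <= v (y + b) ->
    exists b c, [/\ b \in E, y + b != 0, ~~ (2 %| c)%Z & v (y + b) = - c * m%:Z].
  by apply: (main `|1 - v y|%N 0); rewrite ?rpred0 ?addr0//; int_lia.
elim: n b => [|n IH] b bE le_v.
  by have := nvge1 b bE; rewrite vgeE ?yb0//; int_lia.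
have ybM : y + b \in M by rewrite rpredD// (subvP EM).
have /dvdzP[c vc] := dvdz_card_gal_val vL t0 ord_t p0 vp galL ybM (yb0 b bE); rewrite cardM in vc.
have [even_c|odd_c] := boolP (2 %| c)%Z; last first.
  by exists b, (- c); rewrite opprK yb0//; split=> //; move: odd_c; int_lia.
have /dvdzP[j cj] := even_c.
(* As [c] is even, some power of [u] has the valuation of [y + b]; subtracting it times the residue
   [X] of the quotient raises the valuation. *)
pose u := uniformizer p E; have uE : u \in E by apply: mem_uniformizer.
have u0 : u != 0 by apply: uniformizer_neq0.
have ujE : u ^ j \in E by apply: rpredXz.
have uj0 : u ^ j != 0 by rewrite expfz_neq0.
have vu : v (u ^ j) = v (y + b).
  rewrite (valXz vL) ?memvf// (val_uniformizer vL t0 ord_t p0 vp galL).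
  by rewrite vc cj cardE; int_lia.
have [|X resX] := residue_field vL p0 vp (x := (y + b) / u ^ j).
  by rewrite (valM vL) ?memvf ?yb0 ?invr_eq0// (valV vL) ?memvf// vu subrr.
apply: (IH (b - X%:A * u ^ j)); first by rewrite rpredB ?rpredM// rpredZ ?mem1v.
have b'E : b - X%:A * u ^ j \in E by rewrite rpredB ?rpredM// rpredZ ?mem1v.
rewrite -vgeE ?yb0//; apply: (@vge_le _ _ _ _ (1 + v (u ^ j))); first by rewrite vu; int_lia.
have -> : y + (b - X%:A * u ^ j) = ((y + b) / u ^ j - X%:A) * u ^ j.
  by rewrite mulrBl divfK// addrA.
by rewrite (vgeM vL) ?memvf ?vge_refl.
Qed.

End ArtinSchreierValuation.

(** * Valuations and conductors over Laurent series *)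

Section LaurentDegree.
Variable k : fieldType.
Implicit Types X : laurent k.

Lemma degtV_neq0 X : degtV X != 0 -> X != 0.
Proof.
apply: contraNneq => ->; rewrite /degtV; case: xgetP => // n _ [].
by rewrite coefl0 eqxx.
Qed.

Lemma degtVP X : X != 0 -> X (- degtV X) != 0 /\
  forall m : int, degtV X < m -> X (- m) = 0.
Proof.
move=> /laurent_order[m [Xm Xlt]]; rewrite /degtV.
apply: (@xgetPex _ 0 [set n : int | X (- n) != 0 /\ forall m : int, n < m -> X (- m) = 0]).
by exists (- m); rewrite /= opprK; split=> // n nm; apply: Xlt; lia.
Qed.

Lemma monol1_neq0 : monol (1 : k) 1 != 0.
Proof.
apply/eqP => /(congr1 (fun X : laurent k => X 1)).
by rewrite coefl0 /= /monol_coef eqxx => /eqP; rewrite oner_eq0.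
Qed.

Lemma degtV_monol1 : degtV (monol (1 : k) 1) = -1.
Proof.
have [+ _] := degtVP monol1_neq0; rewrite /= /monol_coef.
by case: ifP => [/eqP|_ /eqP//]; lia.
Qed.

Definition ordV X : int := - degtV X.

Lemma ordV_monol1 : ordV (monol 1 1) = 1.
Proof. by rewrite /ordV degtV_monol1 opprK. Qed.

End LaurentDegree.

Section LaurentValuation.
Variables (k : fieldType) (L : splittingFieldType (laurent k)).
Implicit Types (E M : {subfield L}).
Local Notation t := (monol (1 : k) 1).
Local Notation v := (valuation {:L}%AS).
Local Notation N M := ('Gal({:L} / M)%g).

Lemma normalized_val_over M w : normalized_valuation M w ->
  exists e, val_over (@ordV k) M e w.
Proof.
case=> wM wD _ [e e0 wX]; exists e; split=> // X X0.
by rewrite wX// -mulr_natr natz.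
Qed.

Hypotheses (galL : galois 1 {:L}) (totL : totally_ramified {:L}%AS).

(** If there were no normalized valuation, [valuation] would take its default value 0, while total
    ramification makes it positive at [t]. *)
Lemma totally_ramified_normalized : normalized_valuation {:L}%AS v.
Proof.
have [vex|nv] := pselect (exists w, normalized_valuation {:L}%AS w).
  exact: (@xgetPex _ (fun=> 0) [set w | normalized_valuation {:L}%AS w] vex).
have := adim_gt0 {:L}%AS; rewrite -ltz_nat -totL /valuation xgetPN// => w wL.
by apply: nv; exists w.
Qed.

Lemma totally_ramified_val_over : val_over (@ordV k) {:L} (\dim {:L}) v.
Proof.
have [e vL] := normalized_val_over totally_ramified_normalized.
suff -> : \dim {:L} = e by [].
apply/eqP; rewrite -eqz_nat; apply/eqP; rewrite -[LHS]totL.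
by rewrite (val_scalar vL (monol1_neq0 k)) ordV_monol1 mul1r.
Qed.

Lemma totally_ramified_uniformizer : exists2 p : L, p != 0 & v p = 1.
Proof. by have [_ _ [p [_ p0 vp]] _] := totally_ramified_normalized; exists p. Qed.

(** The division is exact on nonzero elements of [M], and the norm of [p] has value 1. *)
Lemma normalized_valuation_sub M :
  normalized_valuation M (fun x => (v x %/ #|N M|)%Z).
Proof.
have vL := totally_ramified_val_over; have [p p0 vp] := totally_ramified_uniformizer.
have cM := card_gal_dim galL M; move: (cardG_gt0 'Gal({:L} / M)).
have dvdM := dvdz_card_gal_val vL (monol1_neq0 k) (ordV_monol1 k) p0 vp galL (M := M).
have vu := val_uniformizer vL (monol1_neq0 k) (ordV_monol1 k) p0 vp galL M.
move: cM dvdM vu; set c := #|N M| => cM dvdM vu c_gt0.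
have c0 : c%:Z != 0 by case: c c_gt0 {cM dvdM vu}.
split=> [x y xM yM x0 y0|x y xM yM x0 y0 xy0||].
- by rewrite (valM vL) ?memvf// divzDl ?dvdM.
- have [a va] := dvdzP (dvdM x xM x0); have [b vb] := dvdzP (dvdM y yM y0).
  have [d vxy] := dvdzP (dvdM _ (rpredD xM yM) xy0).
  have : Num.min (v x) (v y) <= v (x + y).
    by have [_ vD _ _] := vL; rewrite vD ?memvf.
  rewrite va vb vxy !mulzK// !ge_min !ler_pM2r ?ltz_nat//.
- exists (uniformizer p M); split; last by rewrite vu divzz c0.
    exact: mem_uniformizer.
  exact: uniformizer_neq0.
- exists (\dim M) => [|X X0]; first exact: adim_gt0.
  rewrite (val_scalar vL X0) -cM PoszM mulrCA mulKz//.
  by rewrite -[RHS]mulr_natr natz.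
Qed.

(** [valuation M] is only known to be some normalized valuation, hence proportional to [v].
    Comparing at the norm of [p] and at an element of value 1 shows that the factors [e] and
    [\dim M] divide each other. *)
Lemma valuation_sub M x : x \in M -> x != 0 -> v x = #|N M|%:Z * valuation M x.
Proof.
have vL := totally_ramified_val_over; have [p p0 vp] := totally_ramified_uniformizer.
have nM : normalized_valuation M (valuation M).
  by apply: xgetPex; exists (fun x => (v x %/ #|N M|)%Z); apply: normalized_valuation_sub.
have [e wM] := normalized_val_over nM.
have prop := val_over_proportional vL (monol1_neq0 k) (ordV_monol1 k) p0 vp galL wM.
have [_ _ [x1 [x1M x10 wx1]] _] := nM.
have dvdM := dvdz_card_gal_val vL (monol1_neq0 k) (ordV_monol1 k) p0 vp galL (M := M).
have vu := val_uniformizer vL (monol1_neq0 k) (ordV_monol1 k) p0 vp galL M.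
have cM := card_gal_dim galL M; have c_gt0 := cardG_gt0 'Gal({:L} / M).
have [_ _ e_gt0 _] := wM.
have /dvdzP[j vx1] := dvdM x1 x1M x10.
have := prop _ (mem_uniformizer p galL M) (uniformizer_neq0 p0 M).
have := prop _ x1M x10; move=> + + xM x0; have := prop x xM x0.
rewrite vu vx1 wx1 -cM; move: (valuation M x) (v x) (valuation M (uniformizer p M)).
have d_gt0 := adim_gt0 M; move: c_gt0 d_gt0 e_gt0.
rewrite /=; move: #|_| (\dim M) => c d; clear => c_gt0 d_gt0 e_gt0 a b l.
move=> e1 e2 e3.
have c0 : c%:Z != 0 by case: c c_gt0 {e1 e2 e3}.
have d0 : d%:Z != 0 by case: d d_gt0 {e1 e2 e3}.
have el : e%:Z = d%:Z * l by apply: (mulIf c0); lia.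
have dj : d%:Z = e%:Z * j by apply: (mulIf c0); lia.
have l_gt0 : 0 < l by nia.
have lj : l * j = 1 by apply: (mulfI d0); rewrite mulrA -el -dj mulr1.
have {}lj : l * (j : int) = 1 := lj.
have j_gt0 : 0 < (j : int) by rewrite -(pmulr_rgt0 _ l_gt0) lj.
have l1 : l = 1 by nia.
by apply: (mulfI d0); move: e1; rewrite el l1; lia.
Qed.

End LaurentValuation.

(** * Conductors of quadratic steps *)

Section Conductor.
Variables (k : fieldType) (L : splittingFieldType (laurent k)) (R : realType).
Local Notation v := (valuation {:L}%AS).
Local Notation N M := ('Gal({:L} / M)%g).

Lemma conductor_eq (E M : {subfield L}) (c : R) :
  is_lower_break E M 1 c -> conductor R E M = c.
Proof.
move=> cbreak; apply: xget_unique => // d [/= Ad dub]; case: cbreak => Ac cub.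
by apply/le_anti; rewrite cub// dub.
Qed.

Hypotheses (galL : galois 1 {:L}) (totL : totally_ramified {:L}%AS).
Hypothesis char2 : 2%N \in [pchar L].

Let vL := totally_ramified_val_over totL.

(** The nontrivial element moves [x = a + b * y] by [b], whose normalized valuation is at least
    [c + 1] for integral [x], with equality for a uniformizer. *)
Lemma lower_break_Artin_Schreier (E : {subfield L}) (y : L) (c : int) (m : nat) :
  y ^+ 2 + y \in E -> #|N <<E; y>>| = m -> #|N E| = (2 * m)%N ->
  ~~ (2 %| c)%Z -> y != 0 -> v y = - c * m%:Z ->
  is_lower_break E <<E; y>>%AS 1 (c%:~R : R).
Proof.
move=> yE cM cE c_odd y0 vy; set M : {subfield L} := <<E; y>>%AS.
have EM : (E <= M)%VS by exact: subv_adjoin.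
have yM : y \in M by exact: memv_adjoin.
have m_gt0 : (0 < m)%N by rewrite -cM cardG_gt0.
have [p p0 vp] := totally_ramified_uniformizer totL.
have vM x : x \in M -> x != 0 -> v x = m%:Z * valuation M x.
  by rewrite -cM; apply: (valuation_sub galL totL).
have card2 : #|'Gal(M / E)%g| = 2%N.
  rewrite -galois_dim ?galois_Artin_Schreier//.
  have dimM : \dim M = (2 * \dim E)%N.
    apply/eqP; rewrite -(eqn_pmul2l m_gt0) mulnA [(m * 2)%N]mulnC -{1}cM -cE.
    by rewrite !card_gal_dim.
  by rewrite dimM mulnK ?adim_gt0.
have fixE s a : s \in 'Gal(M / E)%g -> a \in E -> s a = a.
  by move=> sG aE; apply: (fixed_gal EM sG aE).
have s_y (s : gal_of M) : s \in 'Gal(M / E)%g -> s y = y \/ s y = y + 1.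
  move=> sG; apply: Artin_Schreier_roots => //.
  by rewrite -rmorphXn -rmorphD /= fixE.
rewrite /is_lower_break /log2_order card2 /=; split.
  suff : 'Gal(M / E)%g \subset lower_group E M (c%:~R : R).
    by move=> /subset_leq_card; rewrite card2.
  apply/fintype.subsetP => s sG.
  rewrite inE sG; apply/asboolP => x xM x0 vx sx.
  have [a [b [aE bE xab]]] := Artin_Schreier_decomp yE xM.
  have sxE : s x = a + b * s y by rewrite xab rmorphD rmorphM /= (fixE s a) ?(fixE s b).
  have [sy|sy] := s_y s sG; first by rewrite sxE sy -xab eqxx in sx.
  have sxb : s x - x = b.
    by rewrite sxE sy xab mulrDr mulr1 opprD addrACA subrr add0r addrAC subrr add0r.
  have b0 : b != 0 by rewrite -sxb subr_eq0.
  have : vge v ((c + 1) * m%:Z) b.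
    apply: (vge_Artin_Schreier galL vL (monol1_neq0 k) (ordV_monol1 k) p0 vp
      cM cE c_odd y0 vy aE bE).
    by rewrite -xab vgeE// vM// mulr_ge0.
  rewrite vgeE// vM ?(subvP EM)// mulrC ler_pM2l ?ltz_nat// => le_c.
  by rewrite sxb -[1]/(1%:~R) -intrD ler_int.
(* Maximality: a nontrivial element of the group at [nu] moves a uniformizer of [M] by an element of
   valuation exactly [c + 1]. *)
move=> nu /= nu_card.
have [s sH s1] : exists2 s, s \in lower_group E M nu & s != 1%g.
  apply/exists_inP; apply: contraTT nu_card.
  rewrite negb_exists_in => /forall_inP h; rewrite -ltnNge ltnS.
  rewrite -(cards1 (1%g : gal_of M)); apply/subset_leq_card/fintype.subsetP => s sH.
  by rewrite inE; have := h s sH; rewrite negbK.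
move: sH; rewrite inE => /andP[sG /asboolP s_nu].
have {s1}sy : s y = y + 1.
  case: (s_y s sG) => // sy; case/eqP: s1; apply/eqP/gal_eqP => x xM.
  have [a [b [aE bE ->]]] := Artin_Schreier_decomp yE xM.
  by rewrite gal_id rmorphD rmorphM /= sy (fixE s a) ?(fixE s b).
pose x := uniformizer p M; have xM : x \in M by apply: mem_uniformizer.
have x0 : x != 0 by apply: uniformizer_neq0.
have vx : v x = m%:Z by rewrite -cM (val_uniformizer vL (monol1_neq0 k) (ordV_monol1 k)).
have [a [b [aE bE xab]]] := Artin_Schreier_decomp yE xM.
have sxb : s x - x = b.
  rewrite xab rmorphD rmorphM /= sy (fixE s a) ?(fixE s b)//.
  by rewrite mulrDr mulr1 opprD addrACA subrr add0r addrAC subrr add0r.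
have [||b0 vb] := val_Artin_Schreier galL vL (monol1_neq0 k) (ordV_monol1 k) p0 vp
  cM cE c_odd y0 vy aE bE; rewrite -?xab//.
have m0 : m%:Z != 0 by case: m m_gt0 {cM cE vy vM vx vb}.
have vMx : valuation M x = 1 by apply: (mulfI m0); rewrite -vM// vx mulr1.
have vMb : valuation M b = c + 1.
  by apply: (mulfI m0); rewrite -vM ?(subvP EM)// vb mulrC.
have := s_nu x xM x0; rewrite vMx sxb vMb -subr_eq0 sxb intrD lerD2r.
by apply.
Qed.

Lemma conductor_Artin_Schreier (E : {subfield L}) (y : L) (c : int) (m : nat) :
  y ^+ 2 + y \in E -> #|N <<E; y>>| = m -> #|N E| = (2 * m)%N ->
  ~~ (2 %| c)%Z -> y != 0 -> v y = - c * m%:Z ->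
  conductor R E <<E; y>>%AS = c%:~R.
Proof.
by move=> yE cM cE c_odd y0 vy; apply/conductor_eq/(lower_break_Artin_Schreier yE cM cE).
Qed.

End Conductor.

(** * The Herbrand function *)

Section Herbrand.
Variables (k : fieldType) (L : splittingFieldType (laurent k)) (R : realType).
Variables (E M : {subfield L}).
Local Notation g nu := (#|lower_group E M (nu : R)|%:R : R).
Local Notation phi := (herbrand_phi E M : R -> R).
Implicit Types (u w : R) (n m : nat).

Definition lower_sum n : R := \sum_(1 <= i < n.+1) g i%:R.

Lemma card_lower_group_ge1 nu : 1 <= g nu.
Proof.
rewrite ler1n; apply/card_gt0P; exists 1%g; rewrite inE group1.
by apply/asboolP => x xM x0 _; rewrite gal_id eqxx.
Qed.

Let g_gt0 nu : 0 < g nu. Proof. exact: lt_le_trans ltr01 (card_lower_group_ge1 nu). Qed.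

Lemma lower_sum0 : lower_sum 0 = 0.
Proof. by rewrite /lower_sum big_geq. Qed.

Lemma lower_sumS n : lower_sum n.+1 = lower_sum n + g n.+1%:R.
Proof. by rewrite /lower_sum big_nat_recr. Qed.

Lemma lower_sum_homo m n : (m <= n)%N -> lower_sum m <= lower_sum n.
Proof.
elim: n => [|n IH]; first by rewrite leqn0 => /eqP ->.
rewrite leq_eqVlt => /predU1P[->//|]; rewrite ltnS => /IH/le_trans; apply.
by rewrite lower_sumS lerDl ltW.
Qed.

Lemma lower_sum_ge n : n%:R <= lower_sum n.
Proof.
elim: n => [|n IH]; first by rewrite lower_sum0.
by rewrite lower_sumS -natr1 lerD// card_lower_group_ge1.
Qed.

Lemma herbrand_phi_le0 u : u <= 0 -> phi u = u.
Proof. by rewrite /herbrand_phi => ->. Qed.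

Lemma herbrand_phiE u n : 0 < u -> n%:R <= u < n.+1%:R ->
  phi u = (lower_sum n + (u - n%:R) * g n.+1%:R) / g 0.
Proof.
move=> u_gt0 u_n; have un : Num.truncn u = n by apply: truncn_def.
by rewrite /herbrand_phi leNgt u_gt0 /= un.
Qed.

Lemma herbrand_phi_nat n : phi n%:R = lower_sum n / g 0.
Proof.
case: n => [|n]; first by rewrite herbrand_phi_le0// lower_sum0 mul0r.
rewrite (@herbrand_phiE _ n.+1) ?ltr0Sn// ?subrr ?mul0r ?addr0//.
by rewrite lexx ltr_nat ltnS leqnn.
Qed.

Lemma herbrand_phi_gt0 u : 0 < u -> 0 < phi u.
Proof.
move=> u_gt0; have u_n := truncn_itv (ltW u_gt0).
rewrite (herbrand_phiE u_gt0 u_n) divr_gt0//; move: u_n.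
case: (Num.truncn u) => [|n] /andP[n_u _]; first by rewrite lower_sum0 add0r subr0 mulr_gt0.
rewrite ltr_wpDr ?mulr_ge0 ?subr_ge0// ?ltW//.
by apply: lt_le_trans (lower_sum_ge _); rewrite ltr0Sn.
Qed.

Lemma herbrand_phi_incr : {homo phi : u w / u < w}.
Proof.
move=> u w uw; have [u_le0|u_gt0] := leP u 0.
  rewrite (herbrand_phi_le0 u_le0); have [w_le0|w_gt0] := leP w 0.
    by rewrite (herbrand_phi_le0 w_le0).
  exact: le_lt_trans u_le0 (herbrand_phi_gt0 w_gt0).
have w_gt0 := lt_trans u_gt0 uw.
have u_n := truncn_itv (ltW u_gt0); have w_n := truncn_itv (ltW w_gt0).
rewrite (herbrand_phiE u_gt0 u_n) (herbrand_phiE w_gt0 w_n) ltr_pM2r ?invr_gt0//.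
move: u_n w_n; set m := Num.truncn u; set n := Num.truncn w => /andP[mu um] /andP[nw wn].
have : (m <= n)%N by rewrite -ltnS -(ltr_nat R); apply: le_lt_trans mu (lt_trans uw wn).
rewrite leq_eqVlt => /orP[/eqP<-|mn]; first by rewrite ltrD2l ltr_pM2r// ltrD2r.
(* Both sides are compared with the value at the integer [m.+1], which lies between [u] and [w]. *)
apply: (@lt_le_trans _ _ (lower_sum m.+1)); last first.
  apply: le_trans (lower_sum_homo mn) _.
  by rewrite lerDl mulr_ge0 ?subr_ge0// ltW.
by rewrite lower_sumS ltrD2l gtr_pMl// ltrBlDl natr1.
Qed.

(** For positive [w], locate [w * g 0] between consecutive values of [lower_sum] and interpolate
    linearly. *)
Lemma herbrand_phi_surj w : exists u, phi u = w.
Proof.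
have [w_le0|w_gt0] := leP w 0; first by exists w; exact: herbrand_phi_le0.
pose z := w * g 0; have z_gt0 : 0 < z by exact: mulr_gt0.
have exn : exists n, z < lower_sum n.
  exists (Num.truncn z).+1; apply: lt_le_trans (lower_sum_ge _).
  by have /andP[] := truncn_itv (ltW z_gt0).
case: (ex_minnP exn) => -[|n] zn min_n; first by rewrite lower_sum0 ltNge (ltW z_gt0) in zn.
have nz : lower_sum n <= z by rewrite leNgt; apply/negP => /min_n; rewrite ltnn.
pose d := (z - lower_sum n) / g n.+1%:R.
have d_ge0 : 0 <= d by rewrite divr_ge0 ?subr_ge0// ltW.
have d_lt1 : d < 1 by rewrite ltr_pdivrMr// mul1r ltrBlDl -lower_sumS.
exists (n%:R + d).
have u_gt0 : 0 < n%:R + d.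
  case: n nz @d d_ge0 d_lt1 {zn min_n} => [|n] nz d d_ge0 d_lt1; last first.
    by rewrite ltr_wpDr// ltr0Sn.
  by rewrite add0r /d lower_sum0 subr0 divr_gt0.
rewrite (@herbrand_phiE _ n)//; last by rewrite lerDl d_ge0 -natr1 ltrD2l.
by rewrite addrAC subrr add0r divfK ?gt_eqF// addrC subrK mulfK ?gt_eqF.
Qed.

Lemma herbrand_phiK u : herbrand_psi E M (phi u) = u.
Proof.
apply: xget_unique => // w /= phi_uw.
by case: (ltgtP w u) => // /herbrand_phi_incr; rewrite phi_uw ltxx.
Qed.

(** [phi] is an increasing bijection with inverse [herbrand_psi], so the upper group at [phi u] is
    the lower group at [u]. *)
Lemma upper_break_phi (i : nat) (l : R) :
  is_lower_break E M i l -> is_upper_break E M i (phi l).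
Proof.
move=> [card_l ub_l]; split; first by rewrite /= /upper_group herbrand_phiK.
move=> w /=; have [u <-] := herbrand_phi_surj w.
rewrite /upper_group herbrand_phiK => /ub_l.
by rewrite le_eqVlt => /predU1P[->//|/herbrand_phi_incr/ltW].
Qed.

End Herbrand.

(** * The dihedral extension *)

Section SumOverCoset.
Variables (K : fieldType) (L : splittingFieldType K) (ord : K -> int).
Variables (v : L -> int) (t : K) (p : L).
Hypotheses (galL : galois 1 {:L}) (vL : val_over ord {:L} (\dim {:L}) v).
Hypotheses (t0 : t != 0) (ord_t : ord t = 1) (p0 : p != 0) (vp : v p = 1).
Local Notation N M := ('Gal({:L} / M)%g).

Lemma mem_gal1 (s : gal_of {:L}) : s \in N 1%AS.
Proof. by rewrite gal_kHom ?sub1v// k1AHom. Qed.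

Lemma mem_gal_adjoin (E : {subfield L}) (y : L) (s : gal_of {:L}) :
  (s \in N <<E; y>>%AS) = (s \in N E) && (s y == y).
Proof.
apply/idP/andP => [sM|[sE /eqP sy]].
  split; first by apply: (fintype.subsetP (galS {:L} (subv_adjoin E y))).
  by apply/eqP/(fixed_gal (subvf _) sM)/memv_adjoin.
rewrite gal_kHom ?subvf//; apply/kHomP_tmp; split=> [|a b _ _]; last exact: rmorphM.
move=> _ /Fadjoin_polyP[f fE ->]; rewrite -horner_map /= sy.
by rewrite (fixedPoly_gal (subvf E) sE fE).
Qed.

(** The two hypotheses of the coset formula are the bound on [b] for integral [a + b * y] and its
    equality case at a uniformizer. *)
Lemma sum_iG_Artin_Schreier (E : {subfield L}) (y : L) (c : int) (m : nat)
    (s : gal_of {:L}) :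
  y ^+ 2 + y \in E -> #|N <<E; y>>| = m -> #|N E| = (2 * m)%N ->
  ~~ (2 %| c)%Z -> y != 0 -> v y = - c * m%:Z -> s \in N E -> s y = y + 1 ->
  \sum_(r in N <<E; y>>%AS) iG v p (r * s)%g = (c + 1) * m%:Z.
Proof.
move=> yE cM cE c_odd y0 vy sE sy.
have sxb a b : a \in E -> b \in E -> s (a + b * y) - (a + b * y) = b.
  move=> aE bE; rewrite rmorphD rmorphM /= sy !(fixed_gal (subvf E) sE)//.
  by rewrite mulrDr mulr1 opprD addrACA subrr add0r addrAC subrr add0r.
apply: (sum_iG_coset vL t0 ord_t p0 vp galL) => [x xM x_int|x xM x0 vx].
  have [a [b [aE bE xab]]] := Artin_Schreier_decomp yE xM.
  rewrite xab sxb//; rewrite xab in x_int.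
  exact: (vge_Artin_Schreier galL vL t0 ord_t p0 vp cM cE c_odd y0 vy aE bE x_int).
have [a [b [aE bE xab]]] := Artin_Schreier_decomp yE xM.
rewrite xab sxb//; rewrite xab in x0 vx; rewrite cM in vx.
exact: (val_Artin_Schreier galL vL t0 ord_t p0 vp cM cE c_odd y0 vy aE bE x0 vx).
Qed.

(** [v y] is negative, as otherwise [X] would be integral; so [y ^+ 2] dominates [y]. *)
Lemma val_Artin_Schreier_generator (y : L) (X : K) :
  y ^+ 2 + y = X%:A -> X != 0 -> ord X < 0 ->
  y != 0 /\ 2 * v y = ord X * (\dim {:L})%:Z.
Proof.
move=> yX X0 X_lt0; have vX := val_scalar vL X0.
have XL0 : X%:A != 0 :> L by rewrite scaler_eq0 negb_or X0 oner_neq0.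
have y0 : y != 0.
  by apply: contraNneq XL0 => y_eq0; rewrite -yX y_eq0 expr0n addr0.
split=> //; have dimL := adim_gt0 {:L}%AS.
have vy2 : v (y ^+ 2) = v y * 2 by rewrite (valXn vL) ?memvf.
have vy_lt0 : v y < 0.
  rewrite ltNge; apply/negP => vy_ge0.
  have : vge v 0 X%:A by rewrite -yX (vgeD vL) ?memvf// vgeE ?expf_neq0// vy2 mulr_ge0.
  by rewrite vgeE// vX leNgt pmulr_llt0 ?ltz_nat// X_lt0.
have [|_] := val_dominant vL (memvf (y ^+ 2)) (memvf y) (expf_neq0 2 y0).
  by rewrite vgeE// vy2; move: vy_lt0; clear; lia.
by rewrite yX vX vy2 => ->; rewrite mulrC.
Qed.

End SumOverCoset.

Section LowerGroup.
Variables (k : fieldType) (L : splittingFieldType (laurent k)) (R : realType).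
Local Notation v := (valuation {:L}%AS).
Hypotheses (totL : totally_ramified {:L}%AS).
Variable p : L.
Hypotheses (p0 : p != 0) (vp : v p = 1).

(** By [iG_min] it suffices to test the condition at [p]. *)
Lemma mem_lower_group (nu : R) (s : gal_of {:L}) :
  (s \in lower_group 1%AS {:L}%AS nu) = (s == 1%g) || (nu + 1 <= (iG v p s)%:~R).
Proof.
have vL := totally_ramified_val_over totL.
rewrite inE mem_gal1; apply/asboolP/orP => [h|h x _ x0 vx sx].
  have [->|s1] := eqVneq s 1%g; [by left|right].
  by apply: h; rewrite ?memvf ?vp// (gal_fix_uniformizer vL p0 vp).
case: h => [/eqP s1|nu_le]; first by rewrite s1 gal_id eqxx in sx.
apply: (le_trans nu_le); rewrite ler_int.
have := iG_min vL (monol1_neq0 k) (ordV_monol1 k) p0 vp s (x := x).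
by rewrite !vgeE ?subr_eq0//; apply.
Qed.

End LowerGroup.

Section HerbrandValues.
Variables (k : fieldType) (L : splittingFieldType (laurent k)) (R : realType).
Variables (E M : {subfield L}).

Lemma lower_sum_const (m n c : nat) : (m <= n)%N ->
  (forall i, (m < i <= n)%N -> #|lower_group E M (i%:R : R)| = c) ->
  lower_sum R E M n = lower_sum R E M m + (n%:R - m%:R) * c%:R.
Proof.
move=> mn cE; rewrite /lower_sum (@big_cat_nat _ _ _ m.+1)//=; congr (_ + _).
rewrite (eq_big_nat _ _ (F2 := fun=> c%:R)); last by move=> i im; rewrite cE.
by rewrite sumr_const_nat subSS -natrB// [RHS]mulr_natl.
Qed.

End HerbrandValues.

Lemma sum_bool3 (V : nmodType) (f : bool * bool * bool -> V) :
  \sum_e f e =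
  f (true, true, true) + f (true, true, false) + f (true, false, true) +
  f (true, false, false) + f (false, true, true) + f (false, true, false) +
  f (false, false, true) + f (false, false, false).
Proof.
transitivity (\sum_e (fun ab c => f (ab, c)) e.1 e.2); first by apply: eq_bigr => -[].
rewrite -(pair_bigA _ (fun ab c => f (ab, c)))/=.
transitivity (\sum_ab (fun a b => \sum_c f (a, b, c)) ab.1 ab.2).
  by apply: eq_bigr => -[].
rewrite -(pair_bigA _ (fun a b => \sum_c f (a, b, c)))/=.
by rewrite !big_bool /= !addrA.
Qed.

(** * Coordinates on the Galois group *)

Section DihedralAction.
Variables (K : fieldType) (L : splittingFieldType K) (q r s : L) (F G H : K).
Hypothesis char2 : 2%N \in [pchar L].
Hypotheses (Eq : q ^+ 2 + q = F%:A) (Er : r ^+ 2 + r = G%:A * q + H%:A).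
Hypotheses (Es : s ^+ 2 + s = G%:A).
Hypothesis EL : <<<<<<1; q>>; r>>; s>>%VS = {:L}%VS.
Implicit Types (g h : gal_of {:L}) (e : bool * bool * bool).

(** If [g] moves [q] by [a], then [g r] and [r + a%:R * s] solve the same Artin-Schreier equation,
    because [a%:R * s] has image [a%:R * G%:A]; [c] is the remaining choice of root. *)
Definition acts g e : Prop := let: (a, b, c) := e in
  [/\ g q = q + a%:R, g s = s + b%:R & g r = r + a%:R * s + c%:R].

Let two0 : 2 = 0 :> L. Proof. by rewrite -[2]/(2%:R) pcharf0. Qed.

Let addbR (a b : bool) : (a (+) b)%:R = a%:R + b%:R :> L.
Proof. by case: a; case: b; rewrite ?addr0 ?add0r//= -[1 + 1]/(2%:R) pcharf0. Qed.

Let boolR_inj (x : L) (a : bool) : (x + a%:R == x) = ~~ a.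
Proof.
by rewrite -subr_eq0 addrAC subrr add0r; case: a; rewrite ?eqxx// oner_eq0.
Qed.

Let roots_bool (x z : L) : z ^+ 2 + z = x ^+ 2 + x -> exists a : bool, z = x + a%:R.
Proof.
by case/(Artin_Schreier_roots char2) => ->; [exists false; rewrite addr0|exists true].
Qed.

Lemma acts_ex g : exists e, acts g e.
Proof.
have [a ga] : exists a : bool, g q = q + a%:R.
  by apply: roots_bool; rewrite -rmorphXn -rmorphD /= Eq gal_scalar.
have [b gb] : exists b : bool, g s = s + b%:R.
  by apply: roots_bool; rewrite -rmorphXn -rmorphD /= Es gal_scalar.
have [c gc] : exists c : bool, g r = r + a%:R * s + c%:R.
  apply: roots_bool; rewrite -rmorphXn -rmorphD /= Er rmorphD rmorphM /= !gal_scalar ga.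
  have a2 : a%:R ^+ 2 = a%:R :> L by case: a {ga}; rewrite ?expr1n// expr0n.
  transitivity ((r ^+ 2 + r) + a%:R * (s ^+ 2 + s)); first by rewrite Er Es; ring.
  transitivity ((r ^+ 2 + r) + (a%:R * s ^+ 2 + a%:R * s) + 2 * (a%:R * r * s)).
    by rewrite two0; ring.
  by rewrite -{1}a2; ring.
by exists (a, b, c).
Qed.

Lemma gal_eq_adjoin (E : {subfield L}) (y : L) g h :
  {in E, g =1 h} -> g y = h y -> {in <<E; y>>%VS, g =1 h}.
Proof.
move=> gh gy _ /Fadjoin_polyP[f /polyOverP fE ->].
rewrite -!horner_map /= gy; congr _.[_].
by apply/polyP => i; rewrite !coef_map /= gh.
Qed.

Lemma acts_inj g h e : acts g e -> acts h e -> g = h.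
Proof.
case: e => -[a b] c [gq gs gr] [hq hs hr]; apply/eqP/gal_eqP => x _.
have : x \in <<<<<<1; q>>; r>>; s>>%VS by rewrite EL memvf.
move: x; apply: gal_eq_adjoin; last by rewrite gs hs.
apply: gal_eq_adjoin; last by rewrite gr hr.
apply: gal_eq_adjoin; last by rewrite gq hq.
by move=> _ /vlineP[X ->]; rewrite !gal_scalar.
Qed.

(** Coordinates determine the element, and there are eight of each, so every triple occurs. *)
Lemma acts_bij : #|{: gal_of {:L}}| = 8%N ->
  exists2 f : bool * bool * bool -> gal_of {:L}, bijective f & forall e, acts (f e) e.
Proof.
move=> card8; have [coord coordP] := choice acts_ex.
have coord_inj : injective coord.
  by move=> g h gh; apply: (acts_inj (coordP g)); rewrite gh.
have [|f fK Kf] := inj_card_bij coord_inj.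
  by rewrite card8 !card_prod card_bool.
by exists f => [|e]; [exists coord|rewrite -{2}[e]Kf].
Qed.

Lemma acts1 : acts 1%g (false, false, false).
Proof. by split; rewrite gal_id ?mul0r !addr0. Qed.

(** The term [a && b'] arises when [h] is applied to [a%:R * s]; it makes the group nonabelian. *)
Lemma actsM g h a b c a' b' c' : acts g (a, b, c) -> acts h (a', b', c') ->
  acts (g * h)%g (a (+) a', b (+) b', c (+) c' (+) (a && b')).
Proof.
move=> [gq gs gr] [hq hs hr]; split; rewrite galM ?memvf//.
- by rewrite gq rmorphD rmorph_nat /= hq addbR; ring.
- by rewrite gs rmorphD rmorph_nat /= hs addbR; ring.
rewrite gr !rmorphD rmorphM !rmorph_nat /= hr hs !addbR -mulnb natrM.
by ring.
Qed.

Lemma acts_fix_q g a b c : acts g (a, b, c) -> (g q == q) = ~~ a.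
Proof. by case=> -> _ _; rewrite boolR_inj. Qed.

Lemma acts_fix_s g a b c : acts g (a, b, c) -> (g s == s) = ~~ b.
Proof. by case=> _ -> _; rewrite boolR_inj. Qed.

Lemma acts_fix_qs g a b c : acts g (a, b, c) -> (g (q + s) == q + s) = ~~ (a (+) b).
Proof. by case=> gq gs _; rewrite rmorphD /= gq gs addrACA -addbR boolR_inj. Qed.

Lemma acts_fix_r g b c : acts g (false, b, c) -> (g r == r) = ~~ c.
Proof. by case=> _ _ ->; rewrite mul0r addr0 boolR_inj. Qed.

End DihedralAction.

(** * Breaks when the lower groups have order 8 up to [l1], then 4 up to [l2], 2 up to [l3], and 1
    beyond *)

Section OrderEightBreaks.
Variables (k : fieldType) (L : splittingFieldType (laurent k)) (R : realType).
Variables (E M : {subfield L}) (l1 l2 l3 : nat).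
Hypotheses (l12 : (l1 <= l2)%N) (l23 : (l2 <= l3)%N).
Hypothesis card8 : #|'Gal(M / E)%g| = 8%N.
Hypothesis card_lower : forall nu : R, #|lower_group E M nu| =
  (1 + (nu <= l3%:R)%R + 4 * (nu <= l1%:R)%R + 2 * (nu <= l2%:R)%R)%N.

Let le12 : (l1%:R : R) <= l2%:R. Proof. by rewrite ler_nat. Qed.
Let le23 : (l2%:R : R) <= l3%:R. Proof. by rewrite ler_nat. Qed.
Let le13 : (l1%:R : R) <= l3%:R. Proof. exact: le_trans le12 le23. Qed.

Let log8 : log2_order E M = 3%N.
Proof. by rewrite /log2_order card8. Qed.

Lemma lower_break1 : is_lower_break E M 1 (l1%:R : R).
Proof.
rewrite /is_lower_break log8; split; first by rewrite /= card_lower lexx le12 le13.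
by move=> nu /=; rewrite card_lower; case: (nu <= l1%:R); case: (_ <= _); case: (_ <= _).
Qed.

Lemma lower_break2 : is_lower_break E M 2 (l2%:R : R).
Proof.
rewrite /is_lower_break log8; split; first by rewrite /= card_lower lexx le23; case: (_ <= _).
move=> nu /=; rewrite card_lower; have [//|gt2] := boolP (nu <= l2%:R).
have /negPf-> : ~~ (nu <= l1%:R) by apply: contra gt2 => /le_trans; apply.
by case: (_ <= _).
Qed.

Lemma lower_break3 : is_lower_break E M 3 (l3%:R : R).
Proof.
rewrite /is_lower_break log8; split; first by rewrite /= card_lower lexx; case: (_ <= _).
move=> nu /=; rewrite card_lower; have [//|gt3] := boolP (nu <= l3%:R).
have /negPf-> : ~~ (nu <= l2%:R) by apply: contra gt3 => /le_trans; apply.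
by have /negPf-> : ~~ (nu <= l1%:R) by apply: contra gt3 => /le_trans; apply.
Qed.

Let card0 : #|lower_group E M (0 : R)| = 8%N.
Proof. by rewrite card_lower !ler0n. Qed.

Let sum1 : lower_sum R E M l1 = l1%:R * 8%:R.
Proof.
rewrite (@lower_sum_const _ _ _ _ _ 0 l1 8)// ?lower_sum0 ?add0r ?subr0// => i /andP[_ il1].
by rewrite card_lower !ler_nat il1 (leq_trans il1 l12) (leq_trans il1 (leq_trans l12 l23)).
Qed.

Let sum2 : lower_sum R E M l2 = l1%:R * 8%:R + (l2%:R - l1%:R) * 4%:R.
Proof.
rewrite (@lower_sum_const _ _ _ _ _ l1 l2 4)// ?sum1// => i /andP[l1i il2].
by rewrite card_lower !ler_nat il2 (leq_trans il2 l23) leqNgt l1i.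
Qed.

Let sum3 : lower_sum R E M l3 =
  l1%:R * 8%:R + (l2%:R - l1%:R) * 4%:R + (l3%:R - l2%:R) * 2%:R.
Proof.
rewrite (@lower_sum_const _ _ _ _ _ l2 l3 2)// ?sum2// => i /andP[l2i il3].
have /negPf i2 : ~~ (i <= l2)%N by rewrite -ltnNge.
have /negPf i1 : ~~ (i <= l1)%N by rewrite -ltnNge (leq_ltn_trans l12).
by rewrite card_lower !ler_nat il3 i2 i1.
Qed.

Lemma upper_break1 : is_upper_break E M 1 (l1%:R : R).
Proof.
have := upper_break_phi lower_break1.
by rewrite herbrand_phi_nat card0 sum1 mulfK// pnatr_eq0.
Qed.

Lemma upper_break2 : is_upper_break E M 2 ((l1%:R + l2%:R) / 2 : R).
Proof.
have := upper_break_phi lower_break2; rewrite herbrand_phi_nat card0 sum2.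
suff -> : (l1%:R * 8%:R + (l2%:R - l1%:R) * 4%:R) / 8%:R = (l1%:R + l2%:R) / 2 :> R by [].
by field.
Qed.

Lemma upper_break3 :
  is_upper_break E M 3 ((l1%:R + l2%:R) / 2 + (l3%:R - l2%:R) / 4 : R).
Proof.
have := upper_break_phi lower_break3; rewrite herbrand_phi_nat card0 sum3.
set x := (X in is_upper_break _ _ _ X -> _); set y := (X in _ -> is_upper_break _ _ _ X).
by suff -> : x = y by []; rewrite /x /y; field.
Qed.

End OrderEightBreaks.

(** * Conductors and the values of [iG] on the eight elements *)

Section DihedralRelations.
Variables (k : fieldType) (L : splittingFieldType (laurent k)) (R : realType).
Variables (q r s : L) (F G H : laurent k).
Local Notation v := (valuation {:L}%AS).
Local Notation N M := ('Gal({:L} / M)%g).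
Hypotheses (galL : galois 1 {:L}) (totL : totally_ramified {:L}%AS).
Hypothesis char2 : 2%N \in [pchar L].
Hypotheses (Eq : q ^+ 2 + q = F%:A) (Er : r ^+ 2 + r = G%:A * q + H%:A).
Hypotheses (Es : s ^+ 2 + s = G%:A).
Hypothesis EL : <<<<<<1; q>>; r>>; s>>%VS = {:L}%VS.
Hypothesis card8 : #|{: gal_of {:L}}| = 8%N.
Variables (cq cs cqs : int).
Hypotheses (q0 : q != 0) (cq_odd : ~~ (2 %| cq)%Z) (vq : v q = - cq * 4).
Hypotheses (s0 : s != 0) (cs_odd : ~~ (2 %| cs)%Z) (vs : v s = - cs * 4).
Hypotheses (qs0 : q + s != 0) (cqs_odd : ~~ (2 %| cqs)%Z) (vqs : v (q + s) = - cqs * 4).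

Lemma sum_gal (f : bool * bool * bool -> gal_of {:L}) (V : nmodType)
    (h : gal_of {:L} -> V) (A : pred (gal_of {:L})) : bijective f ->
  \sum_(g | A g) h g = \sum_e (if A (f e) then h (f e) else 0).
Proof. by move=> f_bij; rewrite (reindex f (onW_bij _ f_bij)) big_mkcond. Qed.

Lemma dihedral_relations : exists A B C Z cr : int,
  [/\ A + C = 2 * (cq + 1), B + C = 2 * (cs + 1), A + B = 2 * (cqs + 1),
      Z + B = 2 * (cr + 1) & conductor R <<1; q>>%AS <<<<1; q>>; r>>%AS = cr%:~R]
  /\ [/\ A <= Z, B <= Z & C <= Z] /\
  (forall nu : R, #|lower_group 1%AS {:L}%AS nu| =
     (1 + (nu + 1 <= Z%:~R)%R + 2 * (nu + 1 <= A%:~R)%R +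
      2 * (nu + 1 <= B%:~R)%R + 2 * (nu + 1 <= C%:~R)%R)%N) /\
  [/\ conductor R 1%AS <<1; q>>%AS = cq%:~R,
      conductor R 1%AS <<1; s>>%AS = cs%:~R &
      conductor R 1%AS <<1; q + s>>%AS = cqs%:~R].
Proof.
have vL := totally_ramified_val_over totL.
have [p p0 vp] := totally_ramified_uniformizer totL.
have [f f_bij fP] := acts_bij char2 Eq Er Es EL card8.
pose I a b c := iG v p (f (a, b, c)).
have fM a b c a' b' c' : (f (a, b, c) * f (a', b', c'))%g =
    f (a (+) a', b (+) b', c (+) c' (+) (a && b')).
  apply: (acts_inj EL (actsM char2 (fP _) (fP _)) (fP _)).
have f1 : f (false, false, false) = 1%g by apply: (acts_inj EL (fP _) (acts1 q r s)).
have f_neq1 a b c : (f (a, b, c) == 1%g) = ~~ [|| a, b | c].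
  by rewrite -f1 (bij_eq f_bij) !xpair_eqE !eqbF_neg !negb_or andbA.
have in_q a b c : (f (a, b, c) \in N <<1; q>>%AS) = ~~ a.
  by rewrite mem_gal_adjoin mem_gal1 (acts_fix_q (fP _)).
have in_s a b c : (f (a, b, c) \in N <<1; s>>%AS) = ~~ b.
  by rewrite mem_gal_adjoin mem_gal1 (acts_fix_s (fP _)).
have in_qs a b c : (f (a, b, c) \in N <<1; q + s>>%AS) = ~~ (a (+) b).
  by rewrite mem_gal_adjoin mem_gal1 (acts_fix_qs char2 (fP _)).
have in_qr a b c : (f (a, b, c) \in N <<<<1; q>>; r>>%AS) = ~~ a && ~~ c.
  rewrite mem_gal_adjoin in_q; case: a => //=.
  by rewrite (acts_fix_r (fP _)).
have c1 : #|N 1%AS| = 8%N.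
  by rewrite -card8; apply: eq_card => g; rewrite mem_gal1.
have cardN (M : {subfield L}) : #|N M| = (\sum_e (if f e \in N M then 1 else 0))%N.
  by rewrite -sum1_card -(sum_gal (fun=> 1%N) _ f_bij).
have c_q : #|N <<1; q>>%AS| = 4%N by rewrite cardN sum_bool3 !in_q.
have c_s : #|N <<1; s>>%AS| = 4%N by rewrite cardN sum_bool3 !in_s.
have c_qs : #|N <<1; q + s>>%AS| = 4%N by rewrite cardN sum_bool3 !in_qs.
have c_qr : #|N <<<<1; q>>; r>>%AS| = 2%N by rewrite cardN sum_bool3 !in_qr.
have q1 : q ^+ 2 + q \in 1%AS by rewrite Eq rpredZ ?mem1v.
have s1 : s ^+ 2 + s \in 1%AS by rewrite Es rpredZ ?mem1v.
have two0 : 2 = 0 :> L by rewrite -[2]/(2%:R) pcharf0.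
have qs1 : (q + s) ^+ 2 + (q + s) \in 1%AS.
  have -> : (q + s) ^+ 2 + (q + s) = (q ^+ 2 + q) + (s ^+ 2 + s) + 2 * (q * s) by ring.
  by rewrite two0 mul0r addr0 rpredD.
have cond := @conductor_Artin_Schreier k L R galL totL char2.
have c8 : #|N 1%AS| = (2 * 4)%N by rewrite c1.
have cond_q : conductor R 1%AS <<1; q>>%AS = cq%:~R by apply: (cond _ _ _ 4).
have cond_s : conductor R 1%AS <<1; s>>%AS = cs%:~R by apply: (cond _ _ _ 4).
have cond_qs : conductor R 1%AS <<1; q + s>>%AS = cqs%:~R by apply: (cond _ _ _ 4).
have sumI := sum_iG_Artin_Schreier galL vL (monol1_neq0 k) (ordV_monol1 k) p0 vp.
pose E : {subfield L} := <<1; q>>%AS.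
have rE : r ^+ 2 + r \in E.
  by rewrite Er rpredD ?rpredM ?memv_adjoin// rpredZ ?mem1v.
have zE : f (false, false, true) \in N E by rewrite in_q.
have zr : f (false, false, true) r = r + 1.
  by have [_ _ ->] := fP (false, false, true); rewrite mul0r addr0.
have c4 : #|N E| = (2 * 2)%N by rewrite c_q.
(* Nothing is known about the parity of the valuation of [r]; translating by an element of [E] gives
   a generator [y] from which the conductor can be read off. *)
have [b [cr [bE y0 cr_odd vy]]] := Artin_Schreier_odd galL vL (monol1_neq0 k)
  (ordV_monol1 k) p0 vp c_qr c4 (subv_adjoin E r) (memv_adjoin E r) zE zr.
pose y := r + b.
have Ey : <<E; y>>%AS = <<E; r>>%AS.
  apply/val_inj/eqP; rewrite eqEsubv; apply/andP; split; apply/FadjoinP; split.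
  - exact: subv_adjoin.
  - by rewrite rpredD ?memv_adjoin// (subvP (subv_adjoin E r)).
  - exact: subv_adjoin.
  - by rewrite -(addrK b r) rpredB ?memv_adjoin// (subvP (subv_adjoin E y)).
have yE : y ^+ 2 + y \in E.
  have -> : y ^+ 2 + y = (r ^+ 2 + r) + (b ^+ 2 + b) + 2 * (r * b) by rewrite /y; ring.
  by rewrite two0 mul0r addr0 rpredD// rpredD// rpredX.
have c_y : #|N <<E; y>>%AS| = 2%N by rewrite Ey.
have cond_r : conductor R E <<E; r>>%AS = cr%:~R.
  by rewrite -Ey; apply: (cond _ _ _ 2).
have zy : f (false, false, true) y = y + 1.
  by rewrite rmorphD /= zr (fixed_gal (subvf E) zE bE) addrAC.
(* This coset consists of the four elements moving [q], which contribute [A] twice and [C] twice.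
   The next two sums are similar. *)
have sum_q : \sum_(g in N <<1; q>>%AS) iG v p (g * f (true, false, false))%g = (cq + 1) * 4.
  apply: (sumI _ _ _ 4) => //; first exact: mem_gal1.
  by have [-> _ _] := fP (true, false, false).
have sum_s : \sum_(g in N <<1; s>>%AS) iG v p (g * f (false, true, false))%g = (cs + 1) * 4.
  apply: (sumI _ _ _ 4) => //; first exact: mem_gal1.
  by have [_ -> _] := fP (false, true, false).
have sum_qs : \sum_(g in N <<1; q + s>>%AS) iG v p (g * f (true, false, false))%g =
    (cqs + 1) * 4.
  apply: (sumI _ _ _ 4) => //; first exact: mem_gal1.
  by have [gq gs _] := fP (true, false, false); rewrite rmorphD /= gq gs addr0 addrAC.
(* Here the coset is the central involution together with one element moving only [s] among [q] and
   [s]. *)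
have sum_r : \sum_(g in N <<E; r>>%AS) iG v p (g * f (false, false, true))%g = (cr + 1) * 2.
  by rewrite -Ey; apply: (sumI _ _ _ 2).
have conj a1 a2 a3 b1 b2 b3 d1 d2 d3 : f (a1, a2, a3) != 1%g ->
    (f (b1, b2, b3) * f (a1, a2, a3))%g = (f (d1, d2, d3) * f (b1, b2, b3))%g ->
    I a1 a2 a3 = I d1 d2 d3.
  exact: (iG_conj vL (monol1_neq0 k) (ordV_monol1 k) p0 vp).
(* Conjugation by a noncommuting element multiplies by the central involution, that is, flips the
   last coordinate. *)
have Iq : I true false false = I true false true.
  by apply: (conj _ _ _ false true false); rewrite ?fM ?f_neq1.
have Is : I false true false = I false true true.
  by apply: (conj _ _ _ true false false); rewrite ?fM ?f_neq1.
have Iqs : I true true false = I true true true.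
  by apply: (conj _ _ _ false true false); rewrite ?fM ?f_neq1.
have Imul a1 a2 a3 b1 b2 b3 : f (a1, a2, a3) != 1%g -> f (b1, b2, b3) != 1%g ->
    (f (a1, a2, a3) * f (b1, b2, b3))%g != 1%g ->
    Num.min (I a1 a2 a3) (I b1 b2 b3) <= iG v p (f (a1, a2, a3) * f (b1, b2, b3))%g.
  exact: (iG_mul vL (monol1_neq0 k) (ordV_monol1 k) p0 vp).
(* All three products equal the central involution; the last one is the square of an element of
   order four. *)
have := Imul true false false true false true; have := Imul false true false false true true.
have := Imul true true false true true false.
rewrite !fM !f_neq1 -Iq -Is !minxx => /(_ isT isT isT) leqs /(_ isT isT isT) les
  /(_ isT isT isT) leq.
move: sum_q sum_s sum_qs sum_r; rewrite !(sum_gal _ _ f_bij) !sum_bool3.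
rewrite !in_q !in_s !in_qs !in_qr !fM /= -!/(I _ _ _) !addr0 !add0r.
rewrite -Iq -Is -Iqs => sum_q sum_s sum_qs sum_r.
exists (I true false false), (I false true false), (I true true false),
  (I false false true), cr; split; [split=> //|split; [split=> //|split; [|split=> //]]].
- by move: sum_q; clear; lia.
- by move: sum_s; clear; lia.
- by move: sum_qs; clear; lia.
- by move: sum_r; clear; lia.
move=> nu; rewrite -sum1_card (sum_gal (fun=> 1%N) _ f_bij) sum_bool3.
rewrite !(mem_lower_group totL p0 vp) !f_neq1 /= -!/(I _ _ _) -Iq -Is -Iqs.
by case: (_ <= _); case: (_ <= _); case: (_ <= _); case: (_ <= _).
Qed.

End DihedralRelations.

Lemma pchar2_laurent (k : fieldType) : 2%N \in [pchar k] -> 2%N \in [pchar (laurent k)].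
Proof.
move=> char2; have two0 : 1 + 1 = 0 :> laurent k.
  apply: laurent_eq => n; rewrite coeflD coefl0 coefl1.
  by case: ifP => _; rewrite ?addr0// -[1 + 1]/(2%:R) pcharf0.
by apply/andP; split=> //; apply/eqP; exact: two0.
Qed.

(** If [f < g], then [d = g], so [A = C = f + 1] and [B = 2 * g - f + 1]. If [f = g], then
    [A = B = d + 1] and [C = 2 * g - d + 1]. The order of the breaks follows from the bounds by
    [Z]. *)
Lemma dihedral_break_values (f g d c A B C Z : int) :
  0 < f -> 0 < d -> f <= g -> d <= g -> (f < g -> d = g) ->
  A + C = 2 * (f + 1) -> B + C = 2 * (g + 1) -> A + B = 2 * (d + 1) ->
  Z + B = 2 * (c + 1) -> A <= Z -> B <= Z -> C <= Z ->
  exists n1 n2 n3 : nat,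
    [/\ n1%:Z = Num.min d f, n2%:Z = 2 * g - n1%:Z,
        n3%:Z = 2 * f + 2 * c - 2 * g - n1%:Z & (n1 <= n2 <= n3)%N] /\
    [/\ Z = n3%:Z + 1, A = n1%:Z + 1 &
        B = n2%:Z + 1 /\ C = n1%:Z + 1 \/ B = n1%:Z + 1 /\ C = n2%:Z + 1].
Proof.
move=> f_gt0 d_gt0 le_fg le_dg d_eq eqA eqB eqC eqZ AZ BZ CZ.
exists (absz (Num.min d f)), (absz (2 * g - Num.min d f)%R), (absz (Z - 1)).
have [lt_fg|le_gf] := ltP f g.
  rewrite (d_eq lt_fg) in eqC *; rewrite (min_idPr (ltW lt_fg)).
  by have dg := d_eq lt_fg; split; [split|split]; lia.
rewrite (min_idPl (le_trans le_dg le_gf)).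
by split; [split|split]; lia.
Qed.

Theorem proposition5p17 (k : fieldType) (L : splittingFieldType (laurent k))
    (R : realType) (F G H : laurent k) (q r s : L)
    (char2 : 2%N \in [pchar k])
    (galL : galois 1 {:L}) (totL : totally_ramified {:L}%AS)
    (D4L : ('Gal({:L} / 1) \isog 'D_8)%g)
    (Eq : q ^+ 2 + q = F%:A) (Er : r ^+ 2 + r = G%:A * q + H%:A)
    (Es : s ^+ 2 + s = G%:A)
    (EL : <<<<<<1; q>>; r>>; s>>%VS = {:L}%VS) :
  let f := degtV F in let g := degtV G in
  let d := degtV (F + G) in let h := degtV H in
  0 < f /\ ~~ (2 %| f)%Z -> 0 < g /\ ~~ (2 %| g)%Z -> 0 < d /\ ~~ (2 %| d)%Z ->
  ~ (0 < h /\ (2 %| h)%Z) -> f <= g ->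
  let cq : R := conductor R 1%AS <<1; q>>%AS in
  let cs : R := conductor R 1%AS <<1; s>>%AS in
  let cqs : R := conductor R 1%AS <<1; q + s>>%AS in
  let cr : R := conductor R <<1; q>>%AS <<<<1; q>>; r>>%AS in
  [/\ is_lower_break 1%AS {:L}%AS 1 (Num.min cqs cq),
      is_lower_break 1%AS {:L}%AS 2 (2 * cs - Num.min cqs cq) &
      is_lower_break 1%AS {:L}%AS 3 (2 * cq + 2 * cr - 2 * cs - Num.min cqs cq)]
  /\
  [/\ is_upper_break 1%AS {:L}%AS 1 (Num.min cqs cq),
      is_upper_break 1%AS {:L}%AS 2 cs &
      is_upper_break 1%AS {:L}%AS 3 ((cq + cr) / 2)].

Proof.
move=> f g d h [f_gt0 f_odd] [g_gt0 g_odd] [d_gt0 d_odd] _ le_fg cq cs cqs cr.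
have char2L : 2%N \in [pchar L] by rewrite pchar_lalg pchar2_laurent.
have card8 : #|{: gal_of {:L}}| = 8%N.
  rewrite -[RHS](card_2dihedral (isT : 1 < 3)%N) -[RHS](card_isog D4L).
  by apply: eq_card => x; rewrite mem_gal1.
have cardG8 : #|'Gal({:L} / 1%AS)%g| = 8%N.
  by rewrite -card8; apply: eq_card => x; rewrite mem_gal1.
have vL := totally_ramified_val_over totL.
have dimL : \dim {:L} = 8%N.
  by rewrite -(card_gal_dim galL 1%AS) cardG8 dimv1 muln1.
(* The ramification index is 8, and [y] has half the valuation of [X], whence the 4. *)
have vgen (y : L) (X : laurent k) : y ^+ 2 + y = X%:A -> 0 < degtV X ->
    y != 0 /\ valuation {:L}%AS y = - degtV X * 4.
  move=> yX X_gt0; have X0 : X != 0 by apply: degtV_neq0; rewrite gt_eqF.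
  have [|y0 vy] := val_Artin_Schreier_generator vL yX X0; first by rewrite /ordV oppr_lt0.
  by split=> //; move: vy; rewrite dimL /ordV; clear; lia.
have [q0 vq] := vgen _ _ Eq f_gt0; have [s0 vs] := vgen _ _ Es g_gt0.
have Eqs : (q + s) ^+ 2 + (q + s) = (F + G)%:A.
  have two0 : 2 = 0 :> L by rewrite -[2]/(2%:R) pcharf0.
  transitivity ((q ^+ 2 + q) + (s ^+ 2 + s) + 2 * (q * s)); first by ring.
  by rewrite two0 mul0r addr0 Eq Es scalerDl.
have [qs0 vqs] := vgen _ _ Eqs d_gt0.
have [A [B [C [Z [c [rels [leZ [card_lower [cond_q cond_s cond_qs]]]]]]]]] :=
  dihedral_relations R galL totL char2L Eq Er Es EL card8 q0 f_odd vq s0 g_odd vs qs0 d_odd vqs.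
case: rels => eq_q eq_s eq_qs eq_r cond_r; case: leZ => AZ BZ CZ.
have vX (X : laurent k) : 0 < degtV X ->
    X%:A != 0 :> L /\ valuation {:L}%AS X%:A = - degtV X * 8.
  move=> X_gt0; have X0 : X != 0 by apply: degtV_neq0; rewrite gt_eqF.
  by rewrite scaler_eq0 negb_or X0 oner_neq0 (val_scalar vL X0) dimL.
have [F0 vF] := vX F f_gt0; have [G0 vG] := vX G g_gt0; have [FG0 vFG] := vX _ d_gt0.
(* The ultrametric properties of the degree are read off from the valuation of [L]. *)
have [d_le d_eq] : d <= g /\ (f < g -> d = g).
  split=> [|lt_fg].
    have : vge (valuation {:L}%AS) (- g * 8) (F + G)%:A.
      rewrite scalerDl (vgeD vL) ?memvf// vgeE// ?vF ?vG ?lexx//.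
      by rewrite ler_pM2r// lerN2.
    by rewrite vgeE// vFG ler_pM2r// lerN2.
  have [|_] := val_dominant vL (memvf G%:A) (memvf F%:A) G0.
    by rewrite vgeE// vF vG; move: lt_fg; rewrite -/f -/g; clear; lia.
  rewrite -scalerDl addrC vFG vG => /mulIf/oppr_inj; exact.
have [n1 [n2 [n3 [[n1E n2E n3E /andP[n12 n23]] [ZE AE BCE]]]]] :=
  dihedral_break_values f_gt0 d_gt0 le_fg d_le d_eq eq_q eq_s eq_qs eq_r AZ BZ CZ.
(* Two of the three noncentral pairs, one of them that of [A], leave the group after [n1] and the
   third after [n2]; the shift by one is that in the definition of the lower groups. *)
have card_lower' (nu : R) : #|lower_group 1%AS {:L}%AS nu| =
  (1 + (nu <= n3%:R)%R + 4 * (nu <= n1%:R)%R + 2 * (nu <= n2%:R)%R)%N.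
  have leE (X : int) (n : nat) : X = n%:Z + 1 -> (nu + 1 <= X%:~R) = (nu <= n%:R).
    by move=> ->; rewrite intrD lerD2r.
  rewrite card_lower (leE _ _ ZE) (leE _ _ AE).
  by case: BCE => -[/leE-> /leE->]; case: (_ <= _); case: (_ <= _); case: (_ <= _).
have minR : Num.min cqs cq = n1%:R.
  by rewrite /cqs /cq cond_q cond_qs -[RHS]/(n1%:Z%:~R) n1E /Order.min ltr_int; case: ifP.
have l2R : 2 * cs - n1%:R = n2%:R :> R.
  by rewrite /cs cond_s -[n2%:R]/(n2%:Z%:~R) n2E rmorphB rmorphM.
have l3R : 2 * cq + 2 * cr - 2 * cs - n1%:R = n3%:R :> R.
  rewrite /cs /cq /cr cond_s cond_q cond_r -[n3%:R]/(n3%:Z%:~R).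
  by rewrite n3E !rmorphB !rmorphD !rmorphM.
have u2R : (n1%:R + n2%:R) / 2 = cs :> R by rewrite -l2R; field.
have u3R : (n1%:R + n2%:R) / 2 + (n3%:R - n2%:R) / 4 = (cq + cr) / 2 :> R.
  by rewrite -l3R -l2R; field.
rewrite minR l2R l3R -u3R -u2R; split; split.
- exact: lower_break1 n12 n23 cardG8 card_lower'.
- exact: lower_break2 n23 cardG8 card_lower'.
- exact: lower_break3 n12 n23 cardG8 card_lower'.
- exact: upper_break1 n12 n23 cardG8 card_lower'.
- exact: upper_break2 n12 n23 cardG8 card_lower'.
- exact: upper_break3 n12 n23 cardG8 card_lower'.
Qed.
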